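(* It is decidable whether a finitely based avoidance set $C=\mathrm{Av}(B)$ of double ascents under the consecutive order is atomic; that is, there is an algorithm which, given a finite set $B$ of double ascents, decides whether the avoidance set $\mathrm{Av}(B)$ of the poset $\mathcal{DA}$ of double ascents under the consecutive order is atomic.
   Context: A permutation of length $n\ge1$ is a sequence $\sigma=\sigma_1\dots\sigma_n$ containing each of $1,\dots,n$ exactly once. An adjacent inversion of $\sigma$ is a pair $(\sigma_i,\sigma_{i+1})$ of consecutive entries with $\sigma_{i+1}<\sigma_i$. A double ascent is a permutation with at most one adjacent inversion. Two sequences of distinct numbers are isomorphic ($\cong$) if replacing in each the smallest number by 1, the second smallest by 2, and so on, gives the same permutation. For a set $X$ of numbers, $\tau\upharpoonright_X$ is the subsequence of $\tau$ consisting of the entries whose values lie in $X$. Consecutive order (with respect to values): for permutations $\sigma$ of length $n$ and $\rho$ of length $m$, $\sigma\leq\rho$ iff $\sigma\cong\rho\upharpoonright_{[k,k+n-1]}$ for some $k\ge1$ with $k+n-1\le m$, where $[k,l]=\{k,k+1,\dots,l\}$. $\mathcal{DA}$ is the set of double ascents with this order. $\mathrm{Av}(B)=\{\rho\in\mathcal{DA}:\sigma\nleq\rho\text{ for all }\sigma\in B\}$. A downward closed subset $C$ of a poset is atomic if it is not the union of two downward closed proper subsets of $C$; equivalently, for all $x,y\in C$ there is $z\in C$ with $x,y\leq z$. *)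

(* Defs.v *)
From HB Require Import structures.
From mathcomp Require Import all_boot classical_sets.

Set Implicit Arguments.
Unset Strict Implicit.
Unset Printing Implicit Defensive.

Local Open Scope classical_set_scope.

(** ** Permutations and double ascents *)

Definition is_permutation (s : seq nat) : bool :=
  (0 < size s) && perm_eq s (iota 1 (size s)).

(* Positions are 0-based: i stands for the pair (s_(i+1), s_(i+2)) of 1-based
   consecutive entries. *)
Definition adjacent_inversions (s : seq nat) : seq nat :=
  [seq i <- iota 0 (size s).-1 | nth 0 s i.+1 < nth 0 s i].

Definition is_double_ascent (s : seq nat) : bool :=
  is_permutation s && (size (adjacent_inversions s) <= 1).

Record DA : Type :=
  MkDA { da_seq :> seq nat; da_seqP : is_double_ascent da_seq }.

HB.instance Definition _ := [isSub for da_seq].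
HB.instance Definition _ := [Countable of DA by <:].

(** ** The consecutive order *)

(* Each entry is replaced by its rank, the smallest having rank 1; meaningful
   for sequences of distinct numbers. *)
Definition standardize (s : seq nat) : seq nat :=
  [seq count (fun y => y <= x) s | x <- s].

Definition isomorphic (s t : seq nat) : Prop := standardize s = standardize t.

Definition restrict_values (t : seq nat) (k l : nat) : seq nat :=
  [seq x <- t | k <= x <= l].

Definition consecutive_le (s r : seq nat) : Prop :=
  exists k : nat, [/\ 1 <= k, k + size s - 1 <= size r
    & isomorphic s (restrict_values r k (k + size s - 1))].

Definition da_le (s r : DA) : Prop := consecutive_le s r.

(** ** Avoidance sets and atomicity *)

Definition Av (B : seq DA) : set DA :=
  [set r | forall s : DA, s \in B -> ~ da_le s r].

Definition down_closed (T : Type) (le : T -> T -> Prop) (C : set T) : Prop :=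
  forall x y : T, C y -> le x y -> C x.

Definition atomic (T : Type) (le : T -> T -> Prop) (C : set T) : Prop :=
  ~ exists C1 C2 : set T,
      [/\ down_closed le C1, down_closed le C2, C1 `<` C, C2 `<` C
        & C = C1 `|` C2].

(** ** Algorithmic decidability *)

(* The (total) general recursive functions: Kleene's class, closed under
   composition, primitive recursion on the first argument, and minimization of
   regular functions. In [rec_min] regularity of [f] is implied by the existence
   of the total function [g] giving the least zero.
   Membership in this class is what makes decidability a nontrivial notion: with
   classical axioms every predicate is reflected by some function to [bool]. *)
Inductive recursive : forall n : nat, (n.-tuple nat -> nat) -> Prop :=
| rec_zero : recursive (fun _ : 0.-tuple nat => 0)
| rec_succ : recursive (fun v : 1.-tuple nat => (thead v).+1)
| rec_proj (n : nat) (i : 'I_n) : recursive (fun v : n.-tuple nat => tnth v i)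
| rec_comp (m n : nat) (f : m.-tuple nat -> nat)
    (g : 'I_m -> n.-tuple nat -> nat) :
    recursive f -> (forall i, recursive (g i)) ->
    recursive (fun v : n.-tuple nat => f [tuple g i v | i < m])
| rec_prim (n : nat) (f : n.-tuple nat -> nat) (g : n.+2.-tuple nat -> nat)
    (h : n.+1.-tuple nat -> nat) :
    recursive f -> recursive g ->
    (forall v : n.-tuple nat, h [tuple of 0 :: v] = f v) ->
    (forall (k : nat) (v : n.-tuple nat),
       h [tuple of k.+1 :: v] = g [tuple of k :: h [tuple of k :: v] :: v]) ->
    recursive h
| rec_min (n : nat) (f : n.+1.-tuple nat -> nat) (g : n.-tuple nat -> nat) :
    recursive f ->
    (forall v : n.-tuple nat, f [tuple of g v :: v] = 0) ->
    (forall (v : n.-tuple nat) (k : nat), k < g v -> f [tuple of k :: v] <> 0) ->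
    recursive g.

Definition algorithmically_decidable (T : Type) (enc : T -> nat)
    (P : T -> Prop) : Prop :=
  exists2 f : 1.-tuple nat -> nat, recursive f &
    forall x : T, (P x -> f [tuple enc x] = 1) /\ (~ P x -> f [tuple enc x] = 0).

(* A finite set of double ascents is given to the algorithm as any list of its
   elements, in any order and possibly with repetitions. [CodeSeq.code] is the
   bijection with [code [::] = 0] and [code (n :: s) = 2 ^ n * (2 * code s + 1)]. *)
Definition encode_basis (B : seq DA) : nat :=
  CodeSeq.code [seq CodeSeq.code (da_seq s) | s <- B].

(* Main.v *)
Require Import Defs.
From mathcomp Require Import all_boot classical_sets.
From mathcomp Require Import boolp zify.

(** A permutation with at most one descent is determined by the set of values
    in its second increasing run, that is, by a binary word whose i-th letter
    tells in which run the value i lies ([perm_of]). Only the ascending words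
    0...01...1 are not determined by their permutation: those of a given length
    all give the identity. Restricting the permutation to an interval of values
    means passing to a factor of the word ([consecutive_leP]). So Av(B) is given
    by the language L of the words with no factor in a finite set, and L is
    closed under factors and under gluing along long overlaps: if xy and yz are
    in L and y has length at least k, then xyz is in L. Here k may be any bound
    on the lengths of the elements of B, and the code of B is such a bound.

    Av(B) is atomic iff any two of its elements have a common upper bound
    ([atomic_directed]), that is, iff any two words of L, replaced if they are
    ascending by ascending words of the same lengths, are factors of one word
    of L ([joinable]). The heart of the proof is [joinable_all]: if this holds
    for words of length at most [horizon k], it holds for all. Consider first
    words with a descent (a letter 1 followed by 0), which must be factors of
    the common word themselves.
    - Either any two short words p, q with a descent are connected by some word
      pxq of L. Then so are long ones, because a given word can be followed by
      everything that can follow a suitable short word with a descent, and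
      similarly on the left.
    - Or some p, q are not connected in this way. A word w of L containing both
      cannot occur twice at a large distance in a word of L, since p followed by
      q would arise; so the longest word z of L that begins and ends with w
      occurs at most once in each word of L. If two short words contain z, then
      in any word of L containing them they are aligned at z. Hence the
      extensions of z to the right, and those to the left, are determined by
      their lengths, and can be chosen independently. As every word of L, up to
      the replacement of ascending words, occurs in a word of L containing z,
      two words are joined by the longest extension in each direction.
    Ascending words are treated by pumping a long block of equal letters.

    A word of L joining u and v can be shortened by the pigeonhole principle
    ([common_superword_bound]), so directedness of Av(B) is equivalent to a
    statement in which every quantifier is bounded by an explicit function of
    the code of B ([atomicity_testP]). It remains to see that this bounded
    search is a recursive function, for which closure of the recursive functions
    under primitive recursion, least-number search and folding over coded
    sequences is established first. *)

Set Implicit Arguments.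
Unset Strict Implicit.
Unset Printing Implicit Defensive.

(** * Recursive functions of an environment *)

Definition env := nat -> nat.
Definition args n (v : env) : n.-tuple nat := [tuple v i | i < n].

Definition rec_with n (f : env -> nat) : Prop :=
  exists2 g, recursive g & forall v, f v = g (args n v).

(** Functions of an infinite environment that only look at finitely many
    variables: this removes all bookkeeping of arities, and passing below a
    binder shifts the variables by conversion. *)
Definition Rec (f : env -> nat) : Prop := exists n, rec_with n f.

Definition push (x : nat) (v : env) : env := fun i => if i is j.+1 then v j else x.

Lemma rec_eq n (f g : n.-tuple nat -> nat) : f =1 g -> recursive f -> recursive g.
Proof. by move=> /funext ->. Qed.

Lemma rec_with_weaken n m f : n <= m -> rec_with n f -> rec_with m f.
Proof.
move=> nm [g rg fg].
exists (fun w : m.-tuple nat => g [tuple tnth w (widen_ord nm i) | i < n]).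
  by apply: (rec_comp (g := fun i w => tnth w (widen_ord nm i))) => // i; apply: rec_proj.
move=> v; rewrite fg; congr g; apply: eq_from_tnth => i.
by rewrite !tnth_mktuple.
Qed.

Lemma rec_with_bound n (h : nat -> env -> nat) :
  (forall i, Rec (h i)) -> exists N, forall i, i < n -> rec_with N (h i).
Proof.
move=> rh; elim: n => [|n [N IH]]; first by exists 0.
have [M rM] := rh n; exists (maxn N M) => i; rewrite ltnS leq_eqVlt => /predU1P[->|].
  by apply: rec_with_weaken rM; apply: leq_maxr.
by move=> /IH; apply: rec_with_weaken; apply: leq_maxl.
Qed.

Lemma Rec_ext f g : f =1 g -> Rec f -> Rec g.
Proof. by move=> /funext ->. Qed.

Lemma Rec_var i : Rec (fun v => v i).
Proof.
exists i.+1; exists (fun w => tnth w ord_max); first exact: rec_proj.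
by move=> v; rewrite tnth_mktuple.
Qed.

(** Closure under composition. As [f] reads finitely many variables, the
    substituted functions have a common arity. *)
Lemma Rec_subst f (h : nat -> env -> nat) :
  Rec f -> (forall i, Rec (h i)) -> Rec (fun v => f (h ^~ v)).
Proof.
move=> [n [g rg fg]] rh; have [N rN] := rec_with_bound n rh.
pose G (i : 'I_n) : N.-tuple nat -> nat := projT1 (cid2 (rN i (ltn_ord i))).
exists N; exists (fun w => g [tuple G i w | i < n]).
  by apply: rec_comp => // i; rewrite /G; case: cid2.
move=> v; rewrite fg; congr g; apply: eq_from_tnth => i.
by rewrite !tnth_mktuple /G; case: cid2.
Qed.

Lemma Rec_app1 (F : nat -> nat) a :
  Rec (fun v => F (v 0)) -> Rec a -> Rec (fun v => F (a v)).
Proof. by move=> rF ra; apply: (Rec_subst (h := fun _ => a) rF). Qed.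

Lemma Rec_succ a : Rec a -> Rec (fun v => (a v).+1).
Proof.
apply: (Rec_app1 (F := S)); exists 1; exists (fun v => (thead v).+1) => [|v].
  exact: rec_succ.
by rewrite /thead tnth_mktuple.
Qed.

Lemma Rec_const c : Rec (fun=> c).
Proof.
elim: c => [|c IH]; last exact: Rec_succ.
by exists 0; exists (fun=> 0); first exact: rec_zero.
Qed.

Lemma args_push n x v : args n.+1 (push x v) = [tuple of x :: args n v].
Proof.
apply: eq_from_tnth => i; rewrite tnth_mktuple.
case: (unliftP ord0 i) => [j|] ->; last by rewrite tnth0.
by rewrite tnthS tnth_mktuple.
Qed.

Definition unargs n (t : n.-tuple nat) : env := nth 0 t.

Lemma unargsK n (t : n.-tuple nat) : args n (unargs t) = t.
Proof. by apply: eq_from_tnth => i; rewrite tnth_mktuple /unargs -tnth_nth. Qed.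

(** Primitive recursion. The step [G] sees the counter, the accumulator and the
    environment, which in the premise are the variables 0, 1 and the later ones. *)
Lemma Rec_iteri (G : nat -> nat -> env -> nat) m a :
  Rec (fun v => G (v 0) (v 1) (fun i => v i.+2)) -> Rec m -> Rec a ->
  Rec (fun v => iteri (m v) (fun i acc => G i acc v) (a v)).
Proof.
move=> [n1 rG] rm [n2 ra]; pose n := maxn n1 n2.
have [ga rga aE] := rec_with_weaken (leq_maxr n1 n2) ra.
have [gG rgG GE] : rec_with n.+2 (fun v => G (v 0) (v 1) (fun i => v i.+2)).
  apply: rec_with_weaken rG; rewrite /n; lia.
have {}GE k acc u : G k acc u = gG [tuple of k :: [tuple of acc :: args n u]].
  by rewrite (GE (push k (push acc u))) !args_push.
pose body (v : env) := iteri (v 0) (fun i acc => G i acc (fun j => v j.+1))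
  (a (fun j => v j.+1)).
suff rb : Rec body.
  by apply: (Rec_subst (h := fun i => if i is j.+1 then fun v => v j else m) rb)
    => -[//|i]; apply: Rec_var.
have E k (t : n.-tuple nat) :
    iteri k (fun i acc => G i acc (unargs t)) (a (unargs t)) =
    iteri k (fun i acc => gG [tuple of i :: [tuple of acc :: t]]) (ga t).
  elim: k => [|k IH] /=; first by rewrite aE unargsK.
  by rewrite -IH GE unargsK.
exists n.+1; exists (fun t => body (unargs t)).
  apply: (rec_prim (f := ga) (g := gG)) => //.
    by move=> t; rewrite -[X in ga X]unargsK -aE.
  move=> k t; rewrite /body iteriS -/(body (unargs [tuple of k :: t])).
  by rewrite (GE k _ (unargs t)) unargsK.
move=> v; rewrite /body.
have -> : unargs (args n.+1 v) 0 = v 0.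
  by rewrite /unargs -(tnth_nth 0 _ ord0) tnth_mktuple.
have argsE : [tuple of behead (args n.+1 v)] = args n (fun j => v j.+1).
  by apply: eq_from_tnth => i; rewrite tnth_behead !tnth_mktuple inordK ?ltnS.
have -> : (fun j => unargs (args n.+1 v) j.+1) = unargs (args n (fun j => v j.+1)).
  by apply: funext => j; rewrite -argsE /unargs /= nth_behead.
by rewrite E -aE; elim: (v 0) => //= k <-; rewrite GE.
Qed.

Definition RecB (P : env -> bool) : Prop := Rec (fun v => P v : nat).
Definition RecL (s : env -> seq nat) : Prop := Rec (fun v => CodeSeq.code (s v)).

Lemma Rec_reindex (r : nat -> nat) f : Rec f -> Rec (fun v => f (fun i => v (r i))).
Proof. by move=> rf; apply: (Rec_subst rf) => i; apply: Rec_var. Qed.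

Lemma RecL_reindex (r : nat -> nat) s :
  RecL s -> RecL (fun v => s (fun i => v (r i))).
Proof. exact: Rec_reindex. Qed.

(** Unbounded search. Since [P] is recursive it ignores all but finitely many
    variables, and so does its least solution [g]. *)
Lemma Rec_least (P : nat -> env -> bool) g :
  Rec (fun v => ~~ P (v 0) (fun i => v i.+1)) ->
  (forall v, P (g v) v) -> (forall v k, P k v -> g v <= k) -> Rec g.
Proof.
move=> [m rP] Pg g_min; have [gP rgP PE] := rec_with_weaken (leqnSn m) rP.
have {}PE k v : nat_of_bool (~~ P k v) = gP [tuple of k :: args m v].
  by rewrite (PE (push k v)) args_push.
have gE v : g v = g (unargs (args m v)).
  have same k : P k v = P k (unargs (args m v)).
    by apply: negb_inj; case: (P k v) (PE k v) (PE k (unargs (args m v)));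
      rewrite unargsK => <-; case: (P _ _).
  by apply/eqP; rewrite eqn_leq !g_min // ?same // -same.
have PEt k (t : m.-tuple nat) : gP [tuple of k :: t] = ~~ P k (unargs t) by rewrite PE unargsK.
exists m; exists (fun t => g (unargs t)) => //.
apply: (rec_min rgP) => t; first by rewrite PEt Pg.
move=> k k_lt; rewrite PEt; case: (boolP (P k _)) => //= /g_min.
by rewrite leqNgt k_lt.
Qed.

(** * Arithmetic and bounded quantification *)

Lemma Rec_if (b : env -> bool) x y :
  RecB b -> Rec x -> Rec y -> Rec (fun v => if b v then x v else y v).
Proof.
move=> rb rx ry; apply: (Rec_ext (f := fun v => iteri (b v) (fun _ _ => x v) (y v))).
  by move=> v; case: (b v).
by apply: (Rec_iteri (G := fun _ _ v => x v)) => //; apply: Rec_reindex.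
Qed.

Lemma Rec_pred a : Rec a -> Rec (fun v => (a v).-1).
Proof.
move=> ra; apply: (Rec_ext (f := fun v => iteri (a v) (fun i _ => i) 0)).
  by move=> v; case: (a v).
by apply: (Rec_iteri (G := fun i _ v => i)) => //; [apply: Rec_var | apply: Rec_const].
Qed.

Lemma Rec_add a b : Rec a -> Rec b -> Rec (fun v => a v + b v).
Proof.
move=> ra rb; apply: (Rec_ext (f := fun v => iteri (b v) (fun _ x => x.+1) (a v))).
  by move=> v; elim: (b v) => [|n IH] /=; rewrite ?addn0 // IH addnS.
by apply: (Rec_iteri (G := fun _ x v => x.+1)) => //; apply/Rec_succ/Rec_var.
Qed.

Lemma Rec_sub a b : Rec a -> Rec b -> Rec (fun v => a v - b v).
Proof.
move=> ra rb; apply: (Rec_ext (f := fun v => iteri (b v) (fun _ x => x.-1) (a v))).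
  by move=> v; elim: (b v) => [|n IH] /=; rewrite ?subn0 // IH subnS.
by apply: (Rec_iteri (G := fun _ x v => x.-1)) => //; apply/Rec_pred/Rec_var.
Qed.

Lemma Rec_mul a b : Rec a -> Rec b -> Rec (fun v => a v * b v).
Proof.
move=> ra rb; apply: (Rec_ext (f := fun v => iteri (b v) (fun _ x => x + a v) 0)).
  by move=> v; elim: (b v) => [|n IH] /=; rewrite ?muln0 // IH mulnS addnC.
apply: (Rec_iteri (G := fun _ x v => x + a v)) => //; last exact: Rec_const.
by apply: Rec_add; [apply: Rec_var | apply: Rec_reindex].
Qed.

Lemma Rec_exp a b : Rec a -> Rec b -> Rec (fun v => a v ^ b v).
Proof.
move=> ra rb; apply: (Rec_ext (f := fun v => iteri (b v) (fun _ x => a v * x) 1)).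
  by move=> v; elim: (b v) => [|n IH] //=; rewrite IH expnS.
apply: (Rec_iteri (G := fun _ x v => a v * x)) => //; last exact: Rec_const.
by apply: Rec_mul; [apply: Rec_reindex | apply: Rec_var].
Qed.

Lemma RecB_negb P : RecB P -> RecB (fun v => ~~ P v).
Proof.
move=> rP; apply: (Rec_ext (f := fun v => 1 - P v)); first by move=> v; case: (P v).
exact/Rec_sub/rP/Rec_const.
Qed.

Lemma RecB_and P Q : RecB P -> RecB Q -> RecB (fun v => P v && Q v).
Proof.
move=> rP rQ; apply: (Rec_ext (f := fun v => P v * Q v)).
  by move=> v; rewrite mulnb.
exact: Rec_mul.
Qed.

Lemma RecB_implb P Q : RecB P -> RecB Q -> RecB (fun v => P v ==> Q v).
Proof.
move=> rP rQ; apply: (Rec_ext (f := fun v => ~~ (P v && ~~ Q v))).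
  by move=> v; case: (P v); case: (Q v).
exact/RecB_negb/RecB_and/RecB_negb.
Qed.

Lemma RecB_leq a b : Rec a -> Rec b -> RecB (fun v => a v <= b v).
Proof.
move=> ra rb; apply: (Rec_ext (f := fun v => 1 - (a v - b v))).
  by move=> v; rewrite /leq; case: (a v - b v).
exact/Rec_sub/Rec_sub/rb/ra/Rec_const.
Qed.

Lemma RecB_eq a b : Rec a -> Rec b -> RecB (fun v => a v == b v).
Proof.
move=> ra rb; apply: (Rec_ext (f := fun v => (a v <= b v) && (b v <= a v))).
  by move=> v; rewrite -eqn_leq.
by apply: RecB_and; apply: RecB_leq.
Qed.

Lemma RecB_all_iota (P : nat -> env -> bool) m :
  RecB (fun v => P (v 0) (fun i => v i.+1)) -> Rec m ->
  RecB (fun v => all (fun i => P i v) (iota 0 (m v))).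
Proof.
move=> rP rm.
apply: (Rec_ext (f := fun v => iteri (m v) (fun i x => P i v * x) 1)).
  move=> v; elim: (m v) => // n IH; rewrite iteriS IH.
  by rewrite -addn1 iotaD all_cat /= add0n andbT andbC mulnb.
apply: (Rec_iteri (G := fun i x v => P i v * x)) => //; last exact: Rec_const.
apply: Rec_mul; last exact: Rec_var.
exact: (Rec_reindex (fun i => if i is j.+1 then j.+2 else 0) rP).
Qed.

Lemma RecB_has_iota (P : nat -> env -> bool) m :
  RecB (fun v => P (v 0) (fun i => v i.+1)) -> Rec m ->
  RecB (fun v => has (fun i => P i v) (iota 0 (m v))).
Proof.
move=> rP rm.
apply: (Rec_ext (f := fun v => ~~ all (fun i => ~~ P i v) (iota 0 (m v)))).
  move=> v; congr nat_of_bool; rewrite -has_predC; apply: eq_has => i.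
  exact: negbK.
exact/RecB_negb/(RecB_all_iota (P := fun i v => ~~ P i v))/rm/RecB_negb.
Qed.

(** * Coded sequences of numbers *)

Lemma code_cons x s : CodeSeq.code (x :: s) = 2 ^ x * (CodeSeq.code s).*2.+1.
Proof. by []. Qed.

Lemma ltn_code_head x s : x < CodeSeq.code (x :: s).
Proof. by have /andP[] := CodeSeq.ltn_code (x :: s). Qed.

Lemma ltn_code_behead x s : CodeSeq.code s < CodeSeq.code (x :: s).
Proof. rewrite code_cons; have := expn_gt0 2 x; nia. Qed.

Lemma code_inj : injective CodeSeq.code.
Proof. exact: can_inj CodeSeq.codeK. Qed.

Lemma RecL_decode a : Rec a -> RecL (fun v => CodeSeq.decode (a v)).
Proof. by apply: Rec_ext => v; rewrite CodeSeq.decodeK. Qed.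

Lemma RecL_cons a s : Rec a -> RecL s -> RecL (fun v => a v :: s v).
Proof.
move=> ra rs; apply: (Rec_ext (f := fun v => 2 ^ a v * (2 * CodeSeq.code (s v)).+1)).
  by move=> v; rewrite code_cons mul2n.
apply: Rec_mul; first by apply: Rec_exp => //; apply: Rec_const.
by apply/Rec_succ/Rec_mul => //; apply: Rec_const.
Qed.

Lemma RecL_nil : RecL (fun=> [::]). Proof. exact: Rec_const. Qed.

(** The code of [x :: l] is [2 ^ x * (2 * t + 1)] with [t] the code of [l]; the
    head is found by searching for the exponent. *)
Lemma Rec_head s : RecL s -> Rec (fun v => head 0 (s v)).
Proof.
move=> rs; pose c v := CodeSeq.code (s v).
pose P k (v : env) := (c v == 0) || has (fun t => c v == 2 ^ k * (2 * t).+1) (iota 0 (c v)).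
apply: (Rec_least (P := P)).
- apply: (Rec_ext (f := fun v => ~~ (~~ (c (fun i => v i.+1) == 0) ==>
      has (fun t => c (fun i => v i.+1) == 2 ^ v 0 * (2 * t).+1)
        (iota 0 (c (fun i => v i.+1)))))).
    by move=> v; rewrite /P; case: (_ == 0).
  have rc : Rec (fun v => c (fun i => v i.+1)) by apply: Rec_reindex.
  apply/RecB_negb/RecB_implb; first exact/RecB_negb/RecB_eq/Rec_const.
  apply: (RecB_has_iota (P := fun t v => c (fun i => v i.+1) == 2 ^ v 0 * (2 * t).+1)) => //.
  apply: RecB_eq; first exact: (Rec_reindex S rc).
  apply: Rec_mul; first exact/Rec_exp/Rec_var/Rec_const.
  by apply/Rec_succ/Rec_mul; [apply: Rec_const | apply: Rec_var].
- move=> v; rewrite /P /c; case: (s v) => //= x l; apply/orP; right; apply/hasP.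
  exists (CodeSeq.code l); last by rewrite mul2n.
  by rewrite mem_iota; apply: ltn_code_behead.
- move=> v k; rewrite /P /c; case E: (s v) => [|x l] //= /orP[|/hasP[t _ /eqP]].
    rewrite -[_ * _]/(CodeSeq.code (x :: l)) => /eqP H.
    by have := ltn_code_head x l; rewrite H.
  rewrite mul2n -(CodeSeq.decodeK t) -[_ * _]/(CodeSeq.code (x :: l)).
  by rewrite -[RHS]/(CodeSeq.code (k :: _)) => /code_inj[->].
Qed.

Lemma RecL_behead s : RecL s -> RecL (fun v => behead (s v)).
Proof.
move=> rs; pose c v := CodeSeq.code (s v).
pose P t (v : env) := c v == 2 ^ head 0 (s v) * (2 * t).+1.
apply: (Rec_least (P := fun t v => P t v || (c v == 0))).
- have rc : Rec (fun v => c (fun i => v i.+1)) by apply: Rec_reindex.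
  apply: (Rec_ext (f := fun v => ~~ (~~ (c (fun i => v i.+1) == 0) ==>
     (c (fun i => v i.+1) == 2 ^ head 0 (s (fun i => v i.+1)) * (2 * v 0).+1)))).
    by move=> v; rewrite /P; case: (c _ == 0); rewrite ?orbT ?orbF.
  apply/RecB_negb/RecB_implb; first exact/RecB_negb/RecB_eq/Rec_const.
  apply: RecB_eq => //; apply: Rec_mul.
    by apply: Rec_exp; [apply: Rec_const | apply: Rec_head; apply: (Rec_reindex S rs)].
  by apply/Rec_succ/Rec_mul; [apply: Rec_const | apply: Rec_var].
- move=> v; rewrite /P /c; case: (s v) => //= x l.
  by rewrite mul2n eqxx.
- move=> v k; rewrite /P /c; case E: (s v) => [|x l] //=.
  rewrite -[2 ^ x * _]/(CodeSeq.code (x :: l)) => /orP[/eqP|/eqP H]; last first.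
    by have := ltn_code_head x l; rewrite H.
  rewrite mul2n -(CodeSeq.decodeK k).
  by rewrite -[RHS]/(CodeSeq.code (x :: _)) => /code_inj[<-].
Qed.

Lemma RecL_drop m s : Rec m -> RecL s -> RecL (fun v => drop (m v) (s v)).
Proof.
move=> rm rs; pose T c := CodeSeq.code (behead (CodeSeq.decode c)).
apply: (Rec_ext (f := fun v => iteri (m v) (fun _ c => T c) (CodeSeq.code (s v)))).
  move=> v; elim: (m v) => [|n /= ->]; first by rewrite drop0.
  by rewrite /T CodeSeq.codeK -drop1 drop_drop add1n.
apply: (Rec_iteri (G := fun _ c v => T c)) => //.
exact/RecL_behead/RecL_decode/Rec_var.
Qed.

Lemma Rec_nth s m : RecL s -> Rec m -> Rec (fun v => nth 0 (s v) (m v)).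
Proof.
move=> rs rm; apply: (Rec_ext (f := fun v => head 0 (drop (m v) (s v)))).
  by move=> v; rewrite -nth0 nth_drop addn0.
exact/Rec_head/RecL_drop.
Qed.

Lemma Rec_size s : RecL s -> Rec (fun v => size (s v)).
Proof.
move=> rs; apply: (Rec_least (P := fun k v => CodeSeq.code (drop k (s v)) == 0)).
- apply/RecB_negb/RecB_eq; last exact: Rec_const.
  by apply: RecL_drop; [apply: Rec_var | apply: RecL_reindex].
- by move=> v; rewrite drop_size.
- move=> v k /eqP/(@code_inj _ [::])/(congr1 size); rewrite size_drop /= => /eqP.
  by rewrite subn_eq0.
Qed.

(** The fold is a primitive recursion which reads the sequence from its end. *)
Lemma Rec_foldr (G : nat -> nat -> env -> nat) s a :
  Rec (fun v => G (v 0) (v 1) (fun i => v i.+2)) -> RecL s -> Rec a ->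
  Rec (fun v => foldr (fun x acc => G x acc v) (a v) (s v)).
Proof.
move=> rG rs ra.
apply: (Rec_ext (f := fun v =>
   iteri (size (s v)) (fun i acc => G (nth 0 (s v) (size (s v) - i.+1)) acc v) (a v))).
  move=> v; move: (s v) => l.
  have gen k : k <= size l ->
      iteri k (fun i acc => G (nth 0 l (size l - i.+1)) acc v) (a v) =
      foldr (fun x acc => G x acc v) (a v) (drop (size l - k) l).
    elim: k => [|k IH] k_le /=; first by rewrite subn0 drop_size.
    rewrite [in RHS](drop_nth 0); last by lia.
    by rewrite /= IH 1?ltnW // subnSK.
  by rewrite gen // subnn drop0.
apply: (Rec_iteri (G := fun i acc v => G (nth 0 (s v) (size (s v) - i.+1)) acc v)) => //.
  apply: (Rec_subst (h := fun j v => match j with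
      | 0 => nth 0 (s (fun i => v i.+2)) (size (s (fun i => v i.+2)) - (v 0).+1)
      | j.+1 => v j.+1 end) rG) => -[|j]; last exact: Rec_var.
  have rs2 : RecL (fun v => s (fun i => v i.+2)) by apply: (RecL_reindex (fun i => i.+2)).
  apply: Rec_nth => //; apply: Rec_sub; first exact: Rec_size.
  exact/Rec_succ/Rec_var.
exact: Rec_size.
Qed.

Lemma RecB_all (P : nat -> env -> bool) s :
  RecB (fun v => P (v 0) (fun i => v i.+1)) -> RecL s ->
  RecB (fun v => all (fun x => P x v) (s v)).
Proof.
move=> rP rs.
apply: (Rec_ext (f := fun v => foldr (fun x acc => P x v * acc) 1 (s v))).
  by move=> v; elim: (s v) => //= x l ->; rewrite mulnb.
apply: (Rec_foldr (G := fun x acc v => P x v * acc)) => //; last exact: Rec_const.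
apply: Rec_mul; last exact: Rec_var.
exact: (Rec_reindex (fun i => if i is j.+1 then j.+2 else 0) rP).
Qed.

Lemma Rec_count (P : nat -> env -> bool) s :
  RecB (fun v => P (v 0) (fun i => v i.+1)) -> RecL s ->
  Rec (fun v => count (fun x => P x v) (s v)).
Proof.
move=> rP rs.
apply: (Rec_ext (f := fun v => foldr (fun x acc => P x v + acc) 0 (s v))).
  by move=> v; elim: (s v) => //= x l ->.
apply: (Rec_foldr (G := fun x acc v => P x v + acc)) => //; last exact: Rec_const.
apply: Rec_add; last exact: Rec_var.
exact: (Rec_reindex (fun i => if i is j.+1 then j.+2 else 0) rP).
Qed.

Lemma RecL_filter (P : nat -> env -> bool) s :
  RecB (fun v => P (v 0) (fun i => v i.+1)) -> RecL s ->
  RecL (fun v => filter (fun x => P x v) (s v)).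
Proof.
move=> rP rs.
apply: (Rec_ext (f := fun v => foldr (fun x acc =>
   if P x v then CodeSeq.code (x :: CodeSeq.decode acc) else acc) 0 (s v))).
  by move=> v; elim: (s v) => //= x l ->; case: (P x v) => //; rewrite CodeSeq.codeK.
apply: (Rec_foldr (G := fun x acc v =>
   if P x v then CodeSeq.code (x :: CodeSeq.decode acc) else acc)) => //;
  last exact: Rec_const.
apply: Rec_if; last exact: Rec_var.
  exact: (Rec_reindex (fun i => if i is j.+1 then j.+2 else 0) rP).
by apply/RecL_cons/RecL_decode/Rec_var/Rec_var.
Qed.

Lemma RecL_map (F : nat -> env -> nat) s :
  Rec (fun v => F (v 0) (fun i => v i.+1)) -> RecL s ->
  RecL (fun v => map (fun x => F x v) (s v)).
Proof.
move=> rF rs.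
apply: (Rec_ext (f := fun v => foldr (fun x acc =>
   CodeSeq.code (F x v :: CodeSeq.decode acc)) 0 (s v))).
  by move=> v; elim: (s v) => //= x l ->; rewrite CodeSeq.codeK.
apply: (Rec_foldr (G := fun x acc v =>
   CodeSeq.code (F x v :: CodeSeq.decode acc))) => //; last exact: Rec_const.
apply: RecL_cons; last exact/RecL_decode/Rec_var.
exact: (Rec_reindex (fun i => if i is j.+1 then j.+2 else 0) rF).
Qed.

Lemma RecL_cat s t : RecL s -> RecL t -> RecL (fun v => s v ++ t v).
Proof.
move=> rs rt.
apply: (Rec_ext (f := fun v => foldr (fun x acc =>
   CodeSeq.code (x :: CodeSeq.decode acc)) (CodeSeq.code (t v)) (s v))).
  by move=> v; elim: (s v) => //= x l ->; rewrite CodeSeq.codeK.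
apply: (Rec_foldr (G := fun x acc v => CodeSeq.code (x :: CodeSeq.decode acc))) => //.
by apply/RecL_cons/RecL_decode/Rec_var/Rec_var.
Qed.

Lemma RecL_iota m n : Rec m -> Rec n -> RecL (fun v => iota (m v) (n v)).
Proof.
move=> rm rn; apply: (Rec_ext (f := fun v =>
    iteri (n v) (fun i acc => CodeSeq.code (CodeSeq.decode acc ++ [:: m v + i])) 0)).
  move=> v; elim: (n v) => // k IH; rewrite iteriS IH.
  by rewrite CodeSeq.codeK -addn1 iotaD.
apply: (Rec_iteri (G := fun i acc v =>
   CodeSeq.code (CodeSeq.decode acc ++ [:: m v + i]))) => //; last exact: Rec_const.
apply: RecL_cat; first exact/RecL_decode/Rec_var.
apply: RecL_cons RecL_nil.
by apply: Rec_add; [apply: Rec_reindex | apply: Rec_var].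
Qed.

Lemma RecB_eqseq s t : RecL s -> RecL t -> RecB (fun v => s v == t v).
Proof.
move=> rs rt; apply: (Rec_ext (f := fun v => CodeSeq.code (s v) == CodeSeq.code (t v))).
  by move=> v; rewrite (inj_eq code_inj).
exact: RecB_eq.
Qed.

Lemma recursive_Rec (F : nat -> nat) :
  Rec (fun v => F (v 0)) -> recursive (fun t : 1.-tuple nat => F (thead t)).
Proof.
move=> [n [g rg FE]]; apply: (rec_eq (f := fun t => g [tuple thead t | i < n])).
  by move=> t; rewrite (FE (fun=> thead t)).
by apply: (rec_comp (g := fun=> fun t => thead t)) => // _; apply: rec_proj.
Qed.

(** * Words and factors *)

Lemma cat_eq_prefix (T : Type) (p1 u1 p2 u2 : seq T) :
  p1 ++ u1 = p2 ++ u2 -> size p1 <= size p2 ->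
  exists2 q, p2 = p1 ++ q & u1 = q ++ u2.
Proof.
move=> E le_p; exists (drop (size p1) p2).
  have := congr1 (take (size p1)) E; rewrite take_size_cat // takel_cat // => {1}->.
  by rewrite cat_take_drop.
have := congr1 (drop (size p1)) E; rewrite drop_size_cat // drop_cat => ->.
by case: ltngtP le_p => // e _; rewrite e subnn drop0 drop_size.
Qed.

Lemma infix_eq (T : eqType) (p s u w : seq T) : w = p ++ u ++ s -> infix u w.
Proof. by move->; apply: infix_infix. Qed.

Lemma infix_catr (T : eqType) (s u w : seq T) : infix u w -> infix u (w ++ s).
Proof. by move=> h; apply: infix_trans h _; apply: prefix_infix. Qed.

(** [infixP] with witnesses of type [seq bool], so that [lia] recognizes their
    sizes. *)
Lemma subword_cat (u w : seq bool) : infix u w -> exists p s : seq bool, w = p ++ u ++ s.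
Proof. by move=> /infixP. Qed.

(** Boolean hypotheses make [lia] split on many irrelevant cases. *)
Ltac size_lia :=
  repeat match goal with
  | H : is_true ?b |- _ =>
      lazymatch b with leq _ _ => fail | _ => clear H end
  | H : @eq bool _ _ |- _ => clear H
  | H : @eq (seq _) _ _ |- _ => clear H
  end; lia.

(** * Ascending words *)

Definition ascending : pred (seq bool) := sorted implb.

Lemma ascending_infix (u w : seq bool) : infix u w -> ascending w -> ascending u.
Proof. by move=> /subword_cat[p [s ->]] /cat_sorted2[_ /cat_sorted2[]]. Qed.

Lemma ascendingP u :
  reflect (exists a b, u = nseq a false ++ nseq b true) (ascending u).
Proof.
apply: (iffP idP) => [|[a [b ->]]]; last first.
  elim: a => [|a] /=; first by case: b => //= b; elim: b.
  by case: a => [|a] //=; case: b.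
elim: u => [|c u IH]; first by exists 0, 0.
case: c => asc_u; last first.
  have /IH[a [b ->]] : ascending u by apply: ascending_infix asc_u; apply: infix_cons.
  by exists a.+1, b.
exists 0, (size u).+1 => /=; congr (_ :: _).
by elim: u asc_u {IH} => //= -[] // u IH; move=> /IH {1}->.
Qed.

Lemma ascending_pump x m c y : 0 < m ->
  ascending (x ++ nseq m.+1 c ++ y) = ascending (x ++ nseq m c ++ y).
Proof.
case: m => // m _; rewrite /ascending; case: x => [|a x] /=; first by rewrite implybb.
by elim: x a => [|b x IH] a /=; [rewrite implybb | rewrite IH].
Qed.

Lemma ascending_run m u : ascending u -> 2 * m <= size u ->
  exists (x : seq bool) c (y : seq bool), u = x ++ nseq m c ++ y.
Proof.
move=> /ascendingP[a [b ->]]; rewrite size_cat !size_nseq => le_m.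
have [ma|mb] : m <= a \/ m <= b by size_lia.
  exists [::], false, (nseq (a - m) false ++ nseq b true).
  by rewrite -{1}(subnKC ma) nseqD -catA.
by exists (nseq a false), true, (nseq (b - m) true); rewrite -{1}(subnKC mb) nseqD.
Qed.

(** Equality of the permutations encoded by two words; see [perm_of_inj] and
    [same_perm_of]. *)
Definition same_perm (u v : seq bool) : bool :=
  (u == v) || [&& ascending u, ascending v & size u == size v].

(** * Languages with gluing *)

Section Language.

Variables (k : nat) (L : pred (seq bool)).
Hypothesis L_infix : forall u w : seq bool, infix u w -> L w -> L u.
Hypothesis L_glue : forall x y z, k <= size y ->
  L (x ++ y) -> L (y ++ z) -> L (x ++ y ++ z).

Lemma pump_down x m c y : k <= m ->
  L (x ++ nseq m.+1 c ++ y) -> L (x ++ nseq m c ++ y).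
Proof.
move=> km Lw; apply: L_glue; rewrite ?size_nseq //; apply: L_infix Lw.
  by rewrite -addn1 nseqD -!catA [x ++ _ ++ _]catA prefix_infix.
by rewrite -add1n nseqD -!catA [x ++ _ ++ _]catA suffix_infix.
Qed.

(** The overlap used for gluing has one letter less than the block, hence the
    strict inequality. *)
Lemma pump_up x m c y : k < m ->
  L (x ++ nseq m c ++ y) -> L (x ++ nseq m.+1 c ++ y).
Proof.
case: m => // m km Lw; rewrite -[m.+2]add1n nseqD -catA catA.
apply: L_glue; first by rewrite size_nseq; size_lia.
  rewrite -[m.+1]addn1 nseqD; apply: L_glue; rewrite ?size_nseq //.
    by apply: L_infix Lw; rewrite -catA -nseqD add1n [x ++ _ ++ _]catA prefix_infix.
  by apply: L_infix Lw; rewrite -nseqD addn1 infix_infix.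
by apply: L_infix Lw; apply: suffix_infix.
Qed.

(** A word longer than [2 ^ k + k] has two equal factors of length [k]. *)
Definition excursion := 2 ^ k + k.

(** Cutting out what lies between two equal factors of length [k] is legal in
    every context at once, because only the overlap matters for gluing. *)
Lemma shorten_step x : excursion < size x ->
  exists2 x', size x' < size x &
    forall u v, L (u ++ x ++ v) -> L (u ++ x' ++ v).
Proof.
rewrite /excursion => x_long.
(* The default value is never taken: these factors all have length [k]. *)
pose f (i : 'I_(2 ^ k).+1) : k.-tuple bool := insubd (nseq_tuple k false) (take k (drop i x)).
have : ~~ injectiveb f.
  apply/injectivePn; apply: contrapT => no_coll.
  have /leq_card : injective f.
    move=> i j fij; apply: contrapT => /eqP ij; apply: no_coll.
    by exists i, j.
  by rewrite card_ord card_tuple card_bool ltnn.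
move=> /injectivePn[i0 [j0 ij0 fij0]].
have {ij0 fij0} [i [j [ij fij]]] : exists i j : 'I_(2 ^ k).+1, i < j /\ f i = f j.
  by move: ij0; rewrite -val_eqE neq_ltn => /orP[]; [exists i0, j0 | exists j0, i0].
have fE (l : 'I_(2 ^ k).+1) : val (f l) = take k (drop l x).
  rewrite /f val_insubd size_take_min size_drop; case: ifP => // /eqP[].
  by have := ltn_ord l; size_lia.
have {}fij : take k (drop i x) = take k (drop j x) by rewrite -!fE fij.
exists (take i x ++ drop j x).
  rewrite size_cat size_drop size_take_min; have := ltn_ord j; size_lia.
move=> u v Lx; rewrite -catA -[drop j x](cat_take_drop k) -fij.
have sz : size (take k (drop i x)) = k.
  rewrite size_take_min size_drop; have := ltn_ord i; size_lia.
have xE l : x = take l x ++ take k (drop l x) ++ drop k (drop l x) by rewrite !cat_take_drop.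
rewrite -catA catA; apply: L_glue; first by rewrite sz.
  move: Lx; rewrite {1}(xE i) -!catA => Lx; apply: L_infix Lx.
  by apply: (infix_eq (p := [::])); rewrite -!catA.
move: Lx; rewrite {1}(xE j) fij -!catA => Lx; apply: L_infix Lx.
by rewrite [X in infix _ X]catA suffix_infix.
Qed.

Lemma shorten x :
  exists2 x', size x' <= excursion &
    forall u v, L (u ++ x ++ v) -> L (u ++ x' ++ v).
Proof.
elim/ltn_ind: {x}(size x) {-2}x (erefl (size x)) => n IH x xn.
have [x_short|/shorten_step[y y_lt xy]] := leqP (size x) excursion; first by exists x.
rewrite xn in y_lt; have [x' x'_le yx'] := IH _ y_lt y erefl.
by exists x' => // u v /xy/yx'.
Qed.

(** In a shortest common superword, either the two factors overlap, or the word
    between them is no longer than an excursion. *)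
Lemma common_superword_bound (u v w : seq bool) : L w -> infix u w -> infix v w ->
  exists w' : seq bool, [/\ L w', infix u w', infix v w'
    & size w' <= size u + size v + excursion].
Proof.
move=> Lw /subword_cat[p1 [s1 w1]] /subword_cat[p2 [s2 w2]].
wlog le_p : u v p1 s1 p2 s2 w1 w2 / size p1 <= size p2.
  move=> gen; have [le|/ltnW le] := leqP (size p1) (size p2).
    exact: (gen _ _ p1 s1 p2 s2).
  have [w' [? ? ? ?]] := gen _ _ _ _ _ _ w2 w1 le.
  by exists w'; split=> //; size_lia.
rewrite w2 in w1; have [q p2E w1E] := cat_eq_prefix (esym w1) le_p.
rewrite w2 p2E -catA in Lw.
have {}Lw : L (q ++ v ++ s2) by apply: L_infix Lw; apply: suffix_infix.
have [q_short|q_long] := leqP (size q) (size u).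
  exists (take (maxn (size u) (size q + size v)) (q ++ v ++ s2)); split.
  - by apply: L_infix Lw; apply: prefixW; apply: prefix_take.
  - by rewrite -w1E take_cat ltnNge leq_maxl /= prefix_infix.
  - rewrite catA take_cat size_cat ltnNge leq_maxr /= -catA; exact: infix_infix.
  - rewrite size_take_min; size_lia.
have [r qE _] := cat_eq_prefix w1E (ltnW q_long).
have [r' r'_short rr'] := shorten r.
exists (u ++ r' ++ v); split.
- apply: rr'; apply: L_infix Lw; rewrite qE -!catA.
  by apply: (infix_eq (p := [::])); rewrite -!catA.
- exact: prefix_infix.
- by rewrite catA suffix_infix.
- by rewrite !size_cat [size r' + _]addnC addnA leq_add2l.
Qed.

Definition joinable (u v : seq bool) := exists w u' v' : seq bool,
  [/\ L w, same_perm u u', same_perm v v', infix u' w & infix v' w].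

(** What may follow [u] in the language is controlled by its last letters; but
    these may be ascending. A short word with a descent that can take the place of
    [u] is obtained by dropping first letters and, when the only descent is at the
    very beginning, by shortening a long block of equal letters. The bound
    ensures that one of the two blocks has at least [k + 2] letters. *)
Lemma descent_core_right u : L u -> ~~ ascending u ->
  exists u', [/\ L u', ~~ ascending u', size u' <= 2 * k + 10
    & forall y, L (u' ++ y) -> L (u ++ y)].
Proof.
elim/ltn_ind: {u}(size u) {-2}u (erefl (size u)) => n IH u un Lu desc_u.
have [u_short|u_long] := leqP (size u) (2 * k + 10); first by exists u; split.
case: u un Lu desc_u u_long => [|c u] //= un Lu desc_cu u_long.
have Lu' : L u by apply: L_infix Lu; apply: infix_cons.
have [asc_u|desc_u] := boolP (ascending u); last first.
  have u_lt : size u < n by size_lia.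
  have [u' [Lu'' desc_u' u'_short uu']] := IH _ u_lt u erefl Lu' desc_u.
  exists u'; split=> // y /uu' Luy; apply: (L_glue (x := [:: c])) => //; size_lia.
have [|x [d [y uE]]] := @ascending_run k.+2 u asc_u; first size_lia.
have Lv : L ((c :: x) ++ nseq k.+1 d ++ y) by apply: pump_down; rewrite /= -?uE.
have desc_v : ~~ ascending ((c :: x) ++ nseq k.+1 d ++ y).
  by rewrite -ascending_pump // cat_cons -uE.
have v_lt : size ((c :: x) ++ nseq k.+1 d ++ y) < n.
  by rewrite -un uE !(size_cat, size_nseq) [size (_ :: _)]/=; size_lia.
have [u' [? ? ? vu']] := IH _ v_lt _ erefl Lv desc_v.
exists u'; split=> // t /vu'; rewrite -!catA => /(pump_up (ltnSn k)).
by rewrite uE -!catA.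
Qed.

(** A block lying inside a factor [u] of [w] can be lengthened in both words. *)
Lemma pump_superword (w u x : seq bool) m c y : k < m -> u = x ++ nseq m c ++ y ->
  L w -> infix u w -> exists p q : seq bool,
  [/\ w = p ++ nseq m c ++ q, L (p ++ nseq m.+1 c ++ q)
    & infix (x ++ nseq m.+1 c ++ y) (p ++ nseq m.+1 c ++ q)].
Proof.
move=> km uE Lw /subword_cat[p [q wE]]; rewrite uE -!catA catA in wE.
exists (p ++ x), (y ++ q); split=> //; first by apply: pump_up; rewrite -?wE.
by apply: (infix_eq (p := p) (s := q)); rewrite -!catA.
Qed.

End Language.

(** * Duality: reversal and complement *)

(** Reversal alone would not preserve ascending words. *)
Definition dual (w : seq bool) : seq bool := map negb (rev w).

Lemma dualK : involutive dual.
Proof.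
move=> w; rewrite /dual -map_rev revK -map_comp map_id_in // => b _.
exact: negbK.
Qed.

Lemma dual_cat u v : dual (u ++ v) = dual v ++ dual u.
Proof. by rewrite /dual rev_cat map_cat. Qed.

Lemma size_dual w : size (dual w) = size w.
Proof. by rewrite size_map size_rev. Qed.

Lemma dual_infix (u w : seq bool) : infix u w -> infix (dual u) (dual w).
Proof. by move=> /subword_cat[p [s ->]]; rewrite !dual_cat -catA infix_infix. Qed.

Lemma ascending_dual w : ascending (dual w) = ascending w.
Proof.
have half u : ascending u -> ascending (dual u).
  move=> /ascendingP[a [b ->]]; apply/ascendingP; exists b, a.
  by rewrite dual_cat /dual !rev_nseq !map_nseq.
by apply/idP/idP => /half //; rewrite dualK.
Qed.

Section DualLanguage.

Variables (k : nat) (L : pred (seq bool)).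
Hypothesis L_infix : forall u w : seq bool, infix u w -> L w -> L u.
Hypothesis L_glue : forall x y z, k <= size y ->
  L (x ++ y) -> L (y ++ z) -> L (x ++ y ++ z).

Definition dual_language : pred (seq bool) := fun w => L (dual w).

Lemma dual_language_infix (u w : seq bool) : infix u w -> dual_language w -> dual_language u.
Proof. by move=> /dual_infix/L_infix. Qed.

Lemma dual_language_glue x y z : k <= size y ->
  dual_language (x ++ y) -> dual_language (y ++ z) -> dual_language (x ++ y ++ z).
Proof.
rewrite /dual_language !dual_cat -catA => y_long Lxy Lyz.
by apply: L_glue; rewrite ?size_dual.
Qed.

Lemma descent_core_left v : L v -> ~~ ascending v ->
  exists v', [/\ L v', ~~ ascending v', size v' <= 2 * k + 10
    & forall x, L (x ++ v') -> L (x ++ v)].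
Proof.
move=> Lv desc_v.
have [||v' [Lv' desc_v' v'_short vv']] :=
  descent_core_right dual_language_infix dual_language_glue (u := dual v).
- by rewrite /dual_language dualK.
- by rewrite ascending_dual.
exists (dual v'); rewrite ascending_dual size_dual; split=> // x Lx.
rewrite -[x]dualK -[v]dualK -dual_cat; apply: vv'.
by rewrite /dual_language dual_cat dualK.
Qed.

End DualLanguage.

(** * Words occurring at most once *)

Definition occurs_once (L : pred (seq bool)) (z : seq bool) := forall s t s' t' : seq bool,
  L (s ++ z ++ t) -> s ++ z ++ t = s' ++ z ++ t' -> size s = size s'.

Definition short_joins (L : pred (seq bool)) K := forall u v : seq bool,
  L u -> L v -> ~~ ascending u -> ~~ ascending v -> size u <= K -> size v <= K ->
  exists w : seq bool, [/\ L w, infix u w & infix v w].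

Section RightExtensions.

Variables (k : nat) (L : pred (seq bool)).
Hypothesis L_infix : forall u w : seq bool, infix u w -> L w -> L u.
Hypothesis L_glue : forall x y z, k <= size y ->
  L (x ++ y) -> L (y ++ z) -> L (x ++ y ++ z).
Variables (z : seq bool) (K : nat).
Hypothesis z_once : occurs_once L z.
Hypothesis desc_z : ~~ ascending z.
Hypothesis z_short : size z + excursion k + k + 1 <= K.
Hypothesis join : short_joins L K.

Lemma descent_catl t : ~~ ascending (z ++ t).
Proof. by apply: contra desc_z; apply/ascending_infix/prefix_infix. Qed.

Lemma descent_catr t : ~~ ascending (t ++ z).
Proof. by apply: contra desc_z; apply/ascending_infix/suffix_infix. Qed.

(** Short extensions [z ++ t] and [z ++ t'] occur in one word of the language,
    where the two occurrences of [z] coincide. For long [t] and [t'] that differ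
    in the last letter, shortening their common part gives a shorter
    counterexample. *)
Lemma right_extension_unique t t' :
  L (z ++ t) -> L (z ++ t') -> size t = size t' -> t = t'.
Proof.
elim/ltn_ind: {t}(size t) {-2}t (erefl (size t)) t' => n IH t tn t' Lt Lt' tt'.
have [t_short|t_long] := leqP (size t) (excursion k).+1.
  have [||w [Lw /subword_cat[p [r wE]] /subword_cat[p' [r' wE']]]] :=
    join Lt Lt' (descent_catl _) (descent_catl _); rewrite ?size_cat ?[size t]tn; try size_lia.
  rewrite -!catA in wE wE'; rewrite wE in Lw wE'.
  have pp' := z_once Lw wE'.
  by move/eqP: wE'; rewrite !eqseq_cat // => /and4P[_ _ /eqP].
case/lastP: t tn Lt tt' t_long => [|t a] //; case/lastP: t' Lt' => [|t' b] //.
  by rewrite size_rcons.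
rewrite !size_rcons => Lt' tn Lt [tt'] t_long.
have E : t = t'.
  by apply: (IH (size t)) => //; [size_lia|apply: L_infix Lt|apply: L_infix Lt'];
    rewrite -cats1 catA prefix_infix.
rewrite -{}E {t' tt'} in Lt' *.
have [x x_lt tx] := shorten_step L_infix L_glue (t_long : excursion k < size t).
move: Lt Lt'; rewrite -!cats1 => /tx La /tx Lb.
have /eqP : x ++ [:: a] = x ++ [:: b].
  by apply: (IH (size x).+1) => //; rewrite ?size_cat ?addn1 //; size_lia.
by rewrite eqseq_cat // => /andP[_ /eqP ->].
Qed.

(** [z] itself may be shorter than [k]. When [s] and [t] are short, a word
    containing [s ++ z] and [z ++ t] contains [s ++ z ++ t] since [z] occurs
    once; otherwise gluing applies to the long side. *)
Lemma glue_over s t : L (s ++ z) -> L (z ++ t) -> L (s ++ z ++ t).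
Proof.
elim: s => [|c s IH] // Ls Lt.
have Ls' : L (s ++ z) by apply: L_infix Ls; apply: infix_cons.
have [s_long|s_short] := leqP k (size s).
  rewrite cat_cons -cat1s; apply: L_glue => //; last exact: IH.
  by apply: L_infix Ls; rewrite cat1s prefix_infix.
move: {IH} (c :: s) (s_short : size (c :: s) <= k) Ls => {}s {}s_short {Ls'} Ls.
elim/last_ind: t Lt => [|t d IH] Lt; first by rewrite cats0.
have Lt' : L (z ++ t) by apply: L_infix Lt; rewrite -cats1 catA prefix_infix.
have [t_long|t_short] := leqP k (size t).
  rewrite -cats1 [s ++ _]catA; apply: L_glue => //; first by rewrite -catA; apply: IH.
  by apply: L_infix Lt; rewrite -cats1 suffix_infix.
have [||w [Lw /subword_cat[p [r wE]] /subword_cat[p' [r' wE']]]] :=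
  join Ls Lt (descent_catr _) (descent_catl _); rewrite ?size_cat ?size_rcons; try size_lia.
rewrite -!catA catA in wE; rewrite -!catA in wE'.
rewrite wE in Lw wE'; have pp' := z_once Lw wE'.
move/eqP: (wE'); rewrite eqseq_cat // => /andP[/eqP psE _].
move: Lw; rewrite wE' -psE => Lw; apply: L_infix Lw.
by apply: (infix_eq (p := p) (s := r')); rewrite -!catA.
Qed.

End RightExtensions.

Section LeftExtensions.

Variables (k : nat) (L : pred (seq bool)).
Hypothesis L_infix : forall u w : seq bool, infix u w -> L w -> L u.
Hypothesis L_glue : forall x y z, k <= size y ->
  L (x ++ y) -> L (y ++ z) -> L (x ++ y ++ z).
Variables (z : seq bool) (K : nat).
Hypothesis z_once : occurs_once L z.
Hypothesis desc_z : ~~ ascending z.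
Hypothesis z_short : size z + excursion k + k + 1 <= K.
Hypothesis join : short_joins L K.

Lemma left_extension_unique s s' :
  L (s ++ z) -> L (s' ++ z) -> size s = size s' -> s = s'.
Proof.
move=> Ls Ls' ss'; apply: (inv_inj dualK).
apply: (right_extension_unique (dual_language_infix L_infix)
  (dual_language_glue L_glue) (z := dual z) (K := K)); rewrite ?ascending_dual ?size_dual //.
- move=> p t p' t'; rewrite /dual_language => Lw wE.
  have {}wE : dual t ++ z ++ dual p = dual t' ++ z ++ dual p'.
    by rewrite -[z]dualK -!dual_cat -!catA wE.
  move: Lw; rewrite !dual_cat dualK -catA => Lw.
  have := z_once Lw wE; rewrite !size_dual => tt'.
  by move/(congr1 size): wE; rewrite !size_cat !size_dual tt'; size_lia.
- move=> u v Lu Lv desc_u desc_v u_short v_short.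
  have [||||||w [Lw uw vw]] := join (u := dual u) (v := dual v);
    rewrite ?ascending_dual ?size_dual //.
  exists (dual w); rewrite /dual_language dualK -[u]dualK -[v]dualK.
  by split=> //; apply: dual_infix.
- by rewrite /dual_language dual_cat !dualK.
- by rewrite /dual_language dual_cat !dualK.
Qed.

(** By uniqueness the shorter of [s] and [s'] is a suffix of the longer, and the
    shorter of [t] and [t'] a prefix of the longer; the two longer ones can be
    combined. *)
Lemma common_extension s t s' t' : L (s ++ z ++ t) -> L (s' ++ z ++ t') ->
  exists S T : seq bool, [/\ L (S ++ z ++ T), infix (s ++ z ++ t) (S ++ z ++ T)
    & infix (s' ++ z ++ t') (S ++ z ++ T)].
Proof.
move=> Lst Lst'.
have left_part p q : L (p ++ z ++ q) -> L (p ++ z).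
  by apply: L_infix; rewrite catA prefix_infix.
have right_part p q : L (p ++ z ++ q) -> L (z ++ q) by apply: L_infix; rewrite suffix_infix.
have left_max p p' : L (p ++ z) -> L (p' ++ z) -> size p <= size p' ->
    exists q, p' = q ++ p.
  move=> Lp Lp' le_p; exists (take (size p' - size p) p').
  rewrite -[LHS](cat_take_drop (size p' - size p)); congr (_ ++ _).
  apply: left_extension_unique => //; last by rewrite size_drop; size_lia.
  apply: L_infix Lp'; apply: (infix_eq (p := take (size p' - size p) p') (s := [::])).
  by rewrite cats0 catA cat_take_drop.
have right_max q q' : L (z ++ q) -> L (z ++ q') -> size q <= size q' ->
    exists r, q' = q ++ r.
  move=> Lq Lq' le_q; exists (drop (size q) q').
  rewrite -[LHS](cat_take_drop (size q)); congr (_ ++ _).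
  apply: (right_extension_unique L_infix L_glue z_once desc_z z_short join) => //.
    apply: L_infix Lq'; apply: (infix_eq (p := [::]) (s := drop (size q) q')).
    by rewrite -catA cat_take_drop.
  by rewrite size_takel.
have glue := glue_over L_infix L_glue z_once desc_z z_short join.
have [S [LS [p pE] [p' p'E]]] : exists S : seq bool, [/\ L (S ++ z), exists p, S = p ++ s
    & exists p, S = p ++ s'].
  have [le|/ltnW le] := leqP (size s) (size s').
    exists s'; split; [exact: left_part Lst' | | by exists [::]].
    exact: left_max _ _ (left_part _ _ Lst) (left_part _ _ Lst') le.
  exists s; split; [exact: left_part Lst | by exists [::] |].
  exact: left_max _ _ (left_part _ _ Lst') (left_part _ _ Lst) le.
have [T [LT [q qE] [q' q'E]]] : exists T : seq bool, [/\ L (z ++ T), exists q, T = t ++ q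
    & exists q, T = t' ++ q].
  have [le|/ltnW le] := leqP (size t) (size t').
    exists t'; split; [exact: right_part Lst' | | by exists [::]; rewrite cats0].
    exact: right_max _ _ (right_part _ _ Lst) (right_part _ _ Lst') le.
  exists t; split; [exact: right_part Lst | by exists [::]; rewrite cats0 |].
  exact: right_max _ _ (right_part _ _ Lst') (right_part _ _ Lst) le.
exists S, T; split; first exact: glue.
- by rewrite pE qE; apply: (infix_eq (p := p) (s := q)); rewrite -!catA.
- by rewrite p'E q'E; apply: (infix_eq (p := p') (s := q')); rewrite -!catA.
Qed.

End LeftExtensions.

(** * Joining short words suffices *)

(** This length exceeds twice that of any block needed for pumping past the
    word [z] of [unique_occurrence_exists], and also [size z + excursion k]
    with some room for gluing. *)
Definition horizon k := 20 * (excursion k + k + 10).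

Section JointEmbedding.

Variables (k : nat) (L : pred (seq bool)).
Hypothesis L_infix : forall u w : seq bool, infix u w -> L w -> L u.
Hypothesis L_glue : forall x y z, k <= size y ->
  L (x ++ y) -> L (y ++ z) -> L (x ++ y ++ z).
Hypothesis joinable_short : forall u v, L u -> L v ->
  size u <= horizon k -> size v <= horizon k -> joinable L u v.

Lemma same_perm_refl u : same_perm u u.
Proof. by rewrite /same_perm eqxx. Qed.

Lemma same_perm_descent u v : ~~ ascending u -> same_perm u v -> v = u.
Proof. by rewrite /same_perm => /negbTE ->; rewrite orbF => /eqP. Qed.

Lemma descent_infix (u w : seq bool) : infix u w -> ~~ ascending u -> ~~ ascending w.
Proof. by move=> uw; apply/contra/ascending_infix. Qed.

Lemma joinable_sym u v : joinable L u v -> joinable L v u.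
Proof. by move=> [w [u' [v' [? ? ? ? ?]]]]; exists w, v', u'. Qed.

Lemma joinable_superwords u v u' v' w :
  L w -> same_perm u u' -> same_perm v v' -> infix u' w -> infix v' w -> joinable L u v.
Proof. by exists w, u', v'. Qed.

(** The longer of the two words joins them: its prefix of the right length is
    ascending. *)
Lemma joinable_ascending u v : L u -> L v -> ascending u -> ascending v ->
  joinable L u v.
Proof.
wlog le_uv : u v / size u <= size v => [gen Lu Lv asc_u asc_v|].
  have [le|/ltnW le] := leqP (size u) (size v); first exact: gen.
  exact/joinable_sym/gen.
move=> Lu Lv asc_u asc_v; have uv : infix (take (size u) v) v by apply/prefixW/prefix_take.
apply: (joinable_superwords Lv _ (same_perm_refl v) uv (infix_refl v)).
by rewrite /same_perm asc_u (ascending_infix uv) // size_takel // eqxx orbT.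
Qed.

Lemma short_descents_join : short_joins L (horizon k).
Proof.
move=> u v Lu Lv desc_u desc_v u_short v_short.
have [w [u' [v' [Lw uu' vv' u'w v'w]]]] := joinable_short Lu Lv u_short v_short.
by exists w; rewrite -(same_perm_descent desc_u uu') -(same_perm_descent desc_v vv').
Qed.

(** Up to equality of permutations, an ascending word is a factor of a word with
    a descent. For long [u] this follows by pumping from [behead u]. *)
Lemma ascending_beside_descent e u : L e -> ~~ ascending e -> size e <= horizon k ->
  L u -> ascending u ->
  exists w u' : seq bool, [/\ L w, ~~ ascending w, same_perm u u' & infix u' w].
Proof.
move=> Le desc_e e_short; elim: u => [|c u IH] Lu asc_u.
  by exists e, [::]; split; rewrite ?infix0s.
have [cu_short|cu_long] := leqP (size (c :: u)) (horizon k).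
  have [w [u' [e' [Lw uu' ee' u'w e'w]]]] := joinable_short Lu Le cu_short e_short.
  exists w, u'; split=> //; apply: descent_infix e'w _.
  by rewrite (same_perm_descent desc_e ee').
have asc_u' : ascending u by apply: ascending_infix asc_u; apply: infix_cons.
have [|w [u' [Lw desc_w uu' u'w]]] := IH _ asc_u'.
  by apply: L_infix Lu; apply: infix_cons.
have [asc_v size_v] : ascending u' /\ size u = size u'.
  by case/orP: uu' => [/eqP <-|/and3P[_ ? /eqP]].
have [|x [d [y u'E]]] := @ascending_run k.+1 u' asc_v.
  by move: cu_long; rewrite /horizon /= size_v; size_lia.
have [p [q [wE Lw' u'w']]] := pump_superword L_infix L_glue (ltnSn k) u'E Lw u'w.
exists (p ++ nseq k.+2 d ++ q), (x ++ nseq k.+2 d ++ y); split=> //.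
  by rewrite ascending_pump // -wE.
rewrite /same_perm asc_u ascending_pump // -u'E asc_v; apply/orP; right; apply/eqP.
by move: size_v; rewrite u'E !size_cat !size_nseq [size (_ :: _)]/=; size_lia.
Qed.

(** The case in which any two short words with a descent are connected. *)
Lemma joinable_connected :
  (forall p q, L p -> L q -> ~~ ascending p -> ~~ ascending q ->
    size p <= 2 * k + 10 -> size q <= 2 * k + 10 -> exists x, L (p ++ x ++ q)) ->
  forall u v, L u -> L v -> joinable L u v.
Proof.
move=> conn.
have joinD u v : L u -> L v -> ~~ ascending u -> ~~ ascending v -> exists x, L (u ++ x ++ v).
  move=> Lu Lv desc_u desc_v.
  have [u' [Lu' desc_u' u'_short uu']] := descent_core_right L_infix L_glue Lu desc_u.
  have [v' [Lv' desc_v' v'_short vv']] := descent_core_left L_infix L_glue Lv desc_v.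
  have [x /uu' Lx] := conn _ _ Lu' Lv' desc_u' desc_v' u'_short v'_short.
  by exists x; rewrite catA; apply: vv'; rewrite -catA.
have joinAD u v : L u -> L v -> ascending u -> ~~ ascending v -> joinable L u v.
  move=> Lu Lv asc_u desc_v.
  have [e [Le desc_e e_short _]] := descent_core_right L_infix L_glue Lv desc_v.
  have [|w [u' [Lw desc_w uu' u'w]]] := ascending_beside_descent Le desc_e _ Lu asc_u.
    by rewrite /horizon; size_lia.
  have [x Lx] := joinD _ _ Lw Lv desc_w desc_v.
  apply: joinable_superwords Lx uu' (same_perm_refl v) _ _; first exact: infix_catr.
  by rewrite catA suffix_infix.
move=> u v Lu Lv; have [asc_u|desc_u] := boolP (ascending u);
  have [asc_v|desc_v] := boolP (ascending v).
- exact: joinable_ascending.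
- exact: joinAD.
- exact/joinable_sym/joinAD.
have [x Lx] := joinD _ _ Lu Lv desc_u desc_v.
apply: joinable_superwords Lx (same_perm_refl u) (same_perm_refl v) _ _.
  exact: prefix_infix.
by rewrite catA suffix_infix.
Qed.

(** The case in which [p] and [q] are not connected. Two disjoint occurrences of
    a word [w] containing both would connect them, so the words beginning and
    ending with [w] have length at most [2 * size w]; a longest one is [z]. If
    [z] occurred twice in a word, the part from the first occurrence to the end
    of the second would be longer. The bound on [z] is twice the bound on [w]
    given by [common_superword_bound]. *)
Lemma unique_occurrence_exists p q : L p -> L q -> ~~ ascending p -> ~~ ascending q ->
  size p <= 2 * k + 10 -> size q <= 2 * k + 10 -> (forall x, ~~ L (p ++ x ++ q)) ->
  exists z, [/\ L z, ~~ ascending z, occurs_once L z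
    & size z <= 2 * (4 * k + 20 + excursion k)].
Proof.
move=> Lp Lq desc_p desc_q p_short q_short noLpq.
have [||w0 [Lw0 pw0 qw0]] := short_descents_join Lp Lq desc_p desc_q;
  rewrite ?/horizon; try size_lia.
have [w [Lw pw qw w_short]] := common_superword_bound L_infix L_glue Lw0 pw0 qw0.
pose Q n := `[< exists x y y' : seq bool, [/\ L x, size x = n, x = w ++ y & x = y' ++ w] >].
have Q_bound n : Q n -> n <= 2 * size w.
  move=> /asboolP[x [y [y' [Lx xn xE xE']]]].
  rewrite leqNgt; apply/negP => n_big; rewrite xE in xE' xn Lx.
  have [|m y'E _] := cat_eq_prefix xE'.
    by move/(congr1 size): xE'; rewrite !size_cat in xn *; size_lia.
  move: pw qw => /subword_cat[p1 [s1 wE1]] /subword_cat[p2 [s2 wE2]].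
  have := noLpq (s1 ++ m ++ p2); rewrite (L_infix _ Lx) // xE' y'E wE1.
  by apply: (infix_eq (p := p1) (s := s2)); rewrite -wE1 {2}wE2 wE1 -!catA.
have Q_ex : exists n, Q n.
  by exists (size w); apply/asboolP; exists w, [::], [::]; rewrite cats0.
have [n /asboolP[z [y [y' [Lz zn zE zE']]]] n_max] := ex_maxnP Q_ex Q_bound.
exists z; split=> //.
- by apply: descent_infix desc_p; apply: infix_trans pw _; rewrite zE prefix_infix.
- have no_later s t s' t' : L (s ++ z ++ t) -> s ++ z ++ t = s' ++ z ++ t' ->
      size s' <= size s.
    move=> Ls sE; rewrite leqNgt; apply/negP => lt_ss'.
    have [r s'E zE''] := cat_eq_prefix sE (ltnW lt_ss').
    have /n_max : Q (size (r ++ z)).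
      have [||m rzE _] := @cat_eq_prefix _ w (y ++ t) (r ++ z) t'.
      - by rewrite catA -zE zE'' -catA.
      - by rewrite zE !size_cat; size_lia.
      apply/asboolP; exists (r ++ z), m, (r ++ y'); split=> //; last by rewrite zE' catA.
      apply: L_infix Ls; rewrite zE''; apply: (infix_eq (p := s) (s := t')).
      by rewrite -!catA.
    rewrite size_cat zn; move: lt_ss'; rewrite s'E size_cat; size_lia.
  move=> s t s' t' Ls sE; apply/eqP; rewrite eqn_leq (no_later _ _ _ _ Ls sE) andbT.
  by apply: (no_later _ _ _ _ _ (esym sE)); rewrite -sE.
- have /Q_bound : Q (size z).
    by apply/asboolP; exists z, y, y'.
  size_lia.
Qed.

Section UniqueOccurrence.

Variable z : seq bool.
Hypothesis Lz : L z.
Hypothesis desc_z : ~~ ascending z.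
Hypothesis z_once : occurs_once L z.
Hypothesis z_short : size z <= 2 * (4 * k + 20 + excursion k).

(** A block of this length cannot be inside an occurrence of [z], and can be
    pumped. *)
Let m := size z + k.+1.

(** As the block is longer than [z], an occurrence of [z] avoids its
    first or its last letter, at which the block can be lengthened. *)
Lemma infix_of_pumped (x y : seq bool) c : infix z (x ++ nseq m c ++ y) ->
  infix z (x ++ nseq m.+1 c ++ y).
Proof.
move=> /subword_cat[p [s E]].
have [le|lt] := leqP (size p + size z) (size x + m).
  have [||r xE _] := @cat_eq_prefix _ (p ++ z) s (x ++ nseq m c) y.
  - by rewrite -!catA E.
  - by rewrite !size_cat size_nseq.
  rewrite -addn1 nseqD; apply: (infix_eq (p := p) (s := r ++ nseq 1 c ++ y)).
  by rewrite -!catA [x ++ _ ++ _]catA xE -!catA.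
have [||r pE yE] := @cat_eq_prefix _ x (nseq m c ++ y) p (z ++ s) => //.
  by rewrite /m in lt; size_lia.
rewrite -add1n nseqD -!catA yE; apply: (infix_eq (p := x ++ nseq 1 c ++ r) (s := s)).
by rewrite -!catA.
Qed.

(** By induction on the length. A long [u] with a long block is obtained by
    pumping from a shorter word. Otherwise [u] is [c :: rcons v d], and both
    [c :: v] and [rcons v d] have a descent, since long ascending words have long
    blocks. These occur in words containing [z]. If [z] ends no later than [c :: v],
    then [d] can be appended there; symmetrically for [rcons v d]. In
    the remaining case gluing along [v] produces a word with two occurrences of
    [z], one starting before [v] and the other not. *)
Lemma beside_unique_occurrence u : L u ->
  exists u' w : seq bool, [/\ same_perm u u', L w, infix u' w & infix z w].
Proof.
elim/ltn_ind: {u}(size u) {-2}u (erefl (size u)) => n IH u un Lu.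
have z_le : size z <= horizon k by rewrite /horizon; size_lia.
have [u_short|u_long] := leqP (size u) (horizon k).
  have [w [u' [z' [Lw uu' zz' u'w]]]] := joinable_short Lu Lz u_short z_le.
  by rewrite (same_perm_descent desc_z zz'); exists u', w.
have [[x [c [y uE]]]|norun] := 
  EM (exists (x : seq bool) c (y : seq bool), u = x ++ nseq m.+1 c ++ y).
  pose u1 := x ++ nseq m c ++ y.
  have size_u : size u = (size u1).+1.
    by rewrite /u1 uE !size_cat !size_nseq; size_lia.
  have asc_u : ascending u = ascending u1 by rewrite uE ascending_pump // /m; size_lia.
  have Lu1 : L u1 by apply: (pump_down L_infix L_glue); rewrite -?uE // /m; size_lia.
  have [|u' [w [uu' Lw u'w zw]]] := IH (size u1) _ u1 erefl Lu1; first size_lia.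
  have km : k < m by rewrite /m; size_lia.
  have [asc|desc] := boolP (ascending u1); last first.
    rewrite (same_perm_descent desc uu') in u'w.
    have [p [q [wE Lw' uw']]] := pump_superword L_infix L_glue km erefl Lw u'w.
    rewrite wE in zw; exists u, (p ++ nseq m.+1 c ++ q); split=> //.
    - exact: same_perm_refl.
    - by rewrite uE.
    - exact: infix_of_pumped.
  have [asc_u' size_u'] : ascending u' /\ size u1 = size u'.
    by case/orP: uu' => [/eqP <-|/and3P[_ ? /eqP]].
  have [|x' [c' [y' u'E]]] := @ascending_run m u' asc_u'.
    by move: u_long; rewrite size_u /m /horizon; size_lia.
  have [p [q [wE Lw' uw']]] := pump_superword L_infix L_glue km u'E Lw u'w.
  rewrite wE in zw; exists (x' ++ nseq m.+1 c' ++ y'), (p ++ nseq m.+1 c' ++ q); split=> //.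
  - have m_gt0 : 0 < m by rewrite /m; size_lia.
    rewrite /same_perm asc_u asc ascending_pump // -u'E asc_u'; apply/orP; right; apply/eqP.
    by rewrite size_u size_u' u'E !size_cat !size_nseq; size_lia.
  - exact: infix_of_pumped.
have desc_part (v : seq bool) : infix v u -> horizon k <= size v -> ~~ ascending v.
  move=> vu v_long; apply/negP => /(@ascending_run m.+1)[|x [c [y vE]]].
    by move: v_long; rewrite /m /horizon; size_lia.
  apply: norun; move: vu => /subword_cat[p [s ->]]; exists (p ++ x), c, (y ++ s).
  by rewrite vE -!catA.
have [c [d [v uE]]] : exists c d (v : seq bool), u = c :: rcons v d.
  case: u u_long {un Lu norun desc_part} => [|c u]; first by rewrite /horizon /=; size_lia.
  case/lastP: u => [|v d]; first by rewrite /horizon /=; size_lia.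
  by exists c, d, v.
have cv_u : infix (c :: v) u by rewrite uE -cats1 -cat_cons prefix_infix.
have vd_u : infix (rcons v d) u by rewrite uE; apply: infix_cons.
have size_u : size u = (size v).+2 by rewrite uE /= size_rcons.
have cv_lt : size (c :: v) < n by rewrite -un size_u.
have vd_lt : size (rcons v d) < n by rewrite -un size_u size_rcons.
have [u1 [w1 [e1 Lw1 u1w1 zw1]]] := IH _ cv_lt _ erefl (L_infix cv_u Lu).
have [u2 [w2 [e2 Lw2 u2w2 zw2]]] := IH _ vd_lt _ erefl (L_infix vd_u Lu).
rewrite {e1}(same_perm_descent _ e1) in u1w1;
  last by apply: desc_part; rewrite /= ?size_u in u_long *.
rewrite {e2}(same_perm_descent _ e2) in u2w2;
  last by apply: desc_part; rewrite ?size_rcons ?size_u in u_long *.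
move: u1w1 u2w2 => /subword_cat[a1 [b1 w1E]] /subword_cat[a2 [b2 w2E]].
move: zw1 zw2 => /subword_cat[s1 [t1 w1E']] /subword_cat[s2 [t2 w2E']].
rewrite w1E in w1E' Lw1; rewrite w2E in w2E' Lw2.
have v_long : k + size z <= size v.
  by move: u_long; rewrite size_u /horizon; size_lia.
exists u.
have [le1|gt1] := leqP (size s1 + size z) (size a1 + (size v).+1).
  exists (a1 ++ u); rewrite same_perm_refl suffix_infix; split=> //.
  - rewrite uE -cats1 -cat1s [_ ++ [:: c] ++ _]catA; apply: L_glue; first size_lia.
      by apply: L_infix Lw1; apply: (infix_eq (p := [::]) (s := b1)); rewrite -!catA.
    by apply: L_infix Lu; rewrite cats1.
  - have [||r rE _] := @cat_eq_prefix _ (s1 ++ z) t1 (a1 ++ c :: v) b1.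
    + by rewrite -!catA -w1E'.
    + by rewrite !size_cat.
    apply: (infix_eq (p := s1) (s := rcons r d)).
    by rewrite uE -cats1 -cat_cons catA rE -!catA cats1.
have [le2|gt2] := leqP (size a2) (size s2).
  exists (u ++ b2); rewrite same_perm_refl prefix_infix; split=> //.
  - rewrite uE -cats1 -cat1s -!catA; apply: L_glue; first size_lia.
      by apply: L_infix Lu; rewrite cat1s.
    by apply: L_infix Lw2; rewrite -cats1 -!catA suffix_infix.
  - have [r _ rE] := cat_eq_prefix w2E' le2.
    by rewrite uE cat_cons rE; apply: (infix_eq (p := c :: r) (s := t2)).
exfalso.
have [||q s1E vE] := @cat_eq_prefix _ (a1 ++ [:: c]) (v ++ b1) s1 (z ++ t1).
- by rewrite -catA w1E' //= -catA.
- by rewrite size_cat /=; size_lia.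
have [||r a2E _] := @cat_eq_prefix _ (s2 ++ z) t2 (a2 ++ v) (d :: b2).
- by rewrite -!catA -w2E' cat_rcons.
- by rewrite !size_cat; size_lia.
have Lavb : L (a2 ++ v ++ b1).
  apply: L_glue; first size_lia.
  - apply: L_infix Lw2; apply: (infix_eq (p := [::]) (s := d :: b2)).
    by rewrite -!catA cat_rcons.
  - apply: L_infix Lw1; apply: (infix_eq (p := a1 ++ [:: c]) (s := [::])).
    by rewrite cats0 -!catA.
have E1 : a2 ++ v ++ b1 = s2 ++ z ++ r ++ b1 by rewrite catA a2E -!catA.
have E2 : s2 ++ z ++ r ++ b1 = (a2 ++ q) ++ z ++ t1 by rewrite -E1 -catA -vE.
rewrite E1 in Lavb; have := z_once Lavb E2; rewrite size_cat; size_lia.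
Qed.

Lemma joinable_unique_occurrence u v : L u -> L v -> joinable L u v.
Proof.
move=> /beside_unique_occurrence[u' [w1 [uu' Lw1 u'w1 /subword_cat[s [t w1E]]]]].
move=> /beside_unique_occurrence[v' [w2 [vv' Lw2 v'w2 /subword_cat[s' [t' w2E]]]]].
rewrite w1E in Lw1 u'w1; rewrite w2E in Lw2 v'w2.
have zK : size z + excursion k + k + 1 <= horizon k by rewrite /horizon; size_lia.
have [S [T [LST w1S w2S]]] :=
  common_extension L_infix L_glue z_once desc_z zK short_descents_join Lw1 Lw2.
apply: joinable_superwords LST uu' vv' _ _; first exact: infix_trans w1S.
exact: infix_trans w2S.
Qed.

End UniqueOccurrence.

Theorem joinable_all u v : L u -> L v -> joinable L u v.
Proof.
have [conn|] := EM (forall p q, L p -> L q -> ~~ ascending p -> ~~ ascending q ->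
    size p <= 2 * k + 10 -> size q <= 2 * k + 10 -> exists x, L (p ++ x ++ q)).
  exact: joinable_connected.
move=> /existsNP[p] /existsNP[q] /not_implyP[Lp] /not_implyP[Lq] /not_implyP[desc_p].
move=> /not_implyP[desc_q] /not_implyP[p_short] /not_implyP[q_short] /forallNP no_path.
have [x|z [Lz desc_z z_once z_short]] :=
  unique_occurrence_exists Lp Lq desc_p desc_q p_short q_short _.
  exact/negP.
exact: joinable_unique_occurrence z_short u v.
Qed.

End JointEmbedding.

(** * Double ascents as binary words *)

Definition run_values (c : bool) (u : seq bool) : seq nat :=
  [seq i <- iota 1 (size u) | nth false u i.-1 == c].

Definition perm_of (u : seq bool) : seq nat := run_values false u ++ run_values true u.

Lemma perm_of_iota u : perm_eq (perm_of u) (iota 1 (size u)).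
Proof.
pose a i := nth false u i.-1 == false.
have -> : perm_of u = filter a (iota 1 (size u)) ++ filter (predC a) (iota 1 (size u)).
  by congr (_ ++ _); apply: eq_filter => i; rewrite /a /=; case: nth.
exact/permEl/perm_filterC.
Qed.

Lemma size_perm_of u : size (perm_of u) = size u.
Proof. by rewrite (perm_size (perm_of_iota u)) size_iota. Qed.

Lemma run_values_sorted c u : sorted ltn (run_values c u).
Proof. exact/(sorted_filter ltn_trans)/iota_ltn_sorted. Qed.

Lemma mem_run_values c u i : i < size u ->
  (i.+1 \in run_values c u) = (nth false u i == c).
Proof. by move=> i_lt; rewrite mem_filter mem_iota /= add1n !ltnS i_lt andbT. Qed.

Lemma word_of_run_values u : u = [seq i \in run_values true u | i <- iota 1 (size u)].
Proof.
apply: (@eq_from_nth _ false) => [|i i_lt]; first by rewrite size_map size_iota.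
by rewrite (nth_map 0) ?size_iota // nth_iota // add1n mem_run_values // eqb_id.
Qed.

Lemma is_permutation_perm_of u : 0 < size u -> is_permutation (perm_of u).
Proof. by move=> u_gt0; rewrite /is_permutation size_perm_of u_gt0 perm_of_iota. Qed.

Lemma perm_of_double_ascent u : 0 < size u -> is_double_ascent (perm_of u).
Proof.
move=> u_gt0; rewrite /is_double_ascent is_permutation_perm_of //=.
set a := size (run_values false u).
have no_inv i : i \in adjacent_inversions (perm_of u) -> i = a.-1.
  rewrite mem_filter mem_iota add0n /= => /andP[inv i_lt].
  have asc c j : j.+1 < size (run_values c u) ->
      nth 0 (run_values c u) j < nth 0 (run_values c u) j.+1.
    exact: (elimT (sortedP 0) (run_values_sorted c u)).
  apply/eqP; apply: contraTT inv => i_neq; rewrite -leqNgt /perm_of !nth_cat -/a.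
  have [i_small|i_big] := ltnP i.+1 a; first by rewrite (ltnW i_small) ltnW // asc.
  have a_le : a <= i by move: i_neq; lia.
  rewrite ltnNge a_le /= subSn // ltnW // asc //.
  by move: i_lt; rewrite /perm_of size_cat -/a; lia.
have : {subset adjacent_inversions (perm_of u) <= [:: a.-1]}.
  by move=> i /no_inv ->; rewrite mem_head.
by apply: uniq_leq_size; rewrite filter_uniq ?iota_uniq.
Qed.

Lemma double_ascent_cat s : is_double_ascent s ->
  exists A B, [/\ s = A ++ B, sorted ltn A & sorted ltn B].
Proof.
move=> /andP[/andP[_ s_perm] one_inv].
have s_uniq : uniq s by rewrite (perm_uniq s_perm) iota_uniq.
have asc i : i.+1 < size s -> i \notin adjacent_inversions s -> nth 0 s i < nth 0 s i.+1.
  move=> i_lt; rewrite mem_filter mem_iota /= add0n => inv.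
  rewrite ltn_neqAle nth_uniq ?(ltnW i_lt) // neq_ltn ltnSn /=.
  by move: inv; rewrite negb_and -leqNgt; case/orP=> //; lia.
case: (adjacent_inversions s) one_inv asc => [|d [|//]] _ asc.
  exists s, [::]; rewrite cats0; split=> //.
  by apply/(sortedP 0) => i i_lt; apply: asc.
exists (take d.+1 s), (drop d.+1 s); rewrite cat_take_drop; split=> //; apply/(sortedP 0) => i.
  rewrite size_take_min => i_lt; rewrite !nth_take; try lia.
  by apply: asc; rewrite ?inE; lia.
rewrite size_drop => i_lt; rewrite !nth_drop addnS.
by apply: asc; rewrite ?inE; lia.
Qed.

Lemma perm_of_surjective s : is_double_ascent s -> exists2 u, 0 < size u & s = perm_of u.
Proof.
move=> s_da; have [A [B [sE A_sorted B_sorted]]] := double_ascent_cat s_da.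
have /andP[/andP[s_gt0 s_perm] _] := s_da.
have s_uniq : uniq s by rewrite (perm_uniq s_perm) iota_uniq.
have mem_s i : (i \in s) = (0 < i <= size s) by rewrite (perm_mem s_perm) mem_iota add1n.
pose u := [seq i \in B | i <- iota 1 (size s)].
have size_u : size u = size s by rewrite size_map size_iota.
exists u; first by rewrite size_u.
have letter i : i \in s -> nth false u i.-1 = (i \in B).
  rewrite mem_s => i_s; rewrite (nth_map 0) ?size_iota; last by lia.
  by rewrite nth_iota ?add1n ?prednK //; lia.
have runE c X : sorted ltn X -> {in s, forall i, (i \in X) = ((i \in B) == c)} ->
    {subset X <= s} -> X = run_values c u.
  move=> X_sorted XE Xs; apply: (irr_sorted_eq ltn_trans ltnn) => // [|i].
    exact: run_values_sorted.
  rewrite mem_filter mem_iota add1n ltnS size_u -mem_s; have [i_s|i_notin] := boolP (i \in s).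
    by rewrite andbT XE // letter.
  by rewrite andbF; apply: contraNF i_notin => /Xs.
rewrite sE /perm_of; congr (_ ++ _); apply: runE => // i.
- rewrite sE mem_cat => i_s; apply/idP/idP; last by case: (i \in B) i_s; rewrite ?orbF.
  move=> iA; move: s_uniq; rewrite sE cat_uniq => /and3P[_ /hasPn AB _].
  by case: (boolP (i \in B)) => // /AB; rewrite iA.
- by move=> iA; rewrite sE mem_cat iA.
- by move=> iB; rewrite sE mem_cat iB orbT.
Qed.

Lemma perm_of_ascending u : ascending u -> perm_of u = iota 1 (size u).
Proof.
move=> /ascendingP[a [b ->]].
have -> : iota 1 (size (nseq a false ++ nseq b true)) = iota 1 a ++ iota a.+1 b.
  by rewrite size_cat !size_nseq iotaD add1n.
have letter i : nth false (nseq a false ++ nseq b true) i.-1 = (a <= i.-1) && (i.-1 < a + b).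
  rewrite nth_cat size_nseq !nth_nseq; case: ltnP => //= ai; by case: ifP; lia.
have runE c : run_values c (nseq a false ++ nseq b true) =
    [seq i <- iota 1 a | false == c] ++ [seq i <- iota a.+1 b | true == c].
  rewrite /run_values size_cat !size_nseq iotaD add1n filter_cat; congr (_ ++ _);
  apply: eq_in_filter => i; rewrite mem_iota => i_in; rewrite letter; congr (_ == _); lia.
by rewrite /perm_of !runE !eqxx !filter_predT !filter_pred0 cats0.
Qed.

Lemma perm_of_sorted_ascending u : sorted ltn (perm_of u) -> ascending u.
Proof.
move=> u_sorted; have permE : perm_of u = iota 1 (size u).
  apply: (irr_sorted_eq ltn_trans ltnn) => //; first exact: iota_ltn_sorted.
  exact/perm_mem/perm_of_iota.
pose a := size (run_values false u).
have trueE : run_values true u = drop a (iota 1 (size u)).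
  by rewrite -permE /perm_of drop_size_cat.
rewrite [u]word_of_run_values /ascending.
have -> : [seq i \in run_values true u | i <- iota 1 (size u)] =
    [seq a < i | i <- iota 1 (size u)].
  by apply/eq_in_map => i; rewrite trueE drop_iota !mem_iota; lia.
apply: (homo_sorted (e := leq)); last exact: iota_sorted.
by move=> i j ij; apply/implyP => ai; apply: leq_trans ai ij.
Qed.

(** Both permutations are the concatenation of two increasing runs. If the first
    runs have equal lengths, the words agree. Otherwise the part between the two
    cutting points lies in the second run of one decomposition and in the first
    run of the other, so the whole permutation is increasing. *)
Lemma perm_of_inj u v : perm_of u = perm_of v -> same_perm u v.
Proof.
wlog le_uv : u v / size (run_values false u) <= size (run_values false v).
  move=> gen uv; have [le|/ltnW le] :=
    leqP (size (run_values false u)) (size (run_values false v)); first exact: gen.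
  have := gen _ _ le (esym uv).
  by rewrite /same_perm [v == u]eq_sym [size v == _]eq_sym andbCA.
move=> uv; have size_uv : size u = size v by rewrite -!size_perm_of uv.
rewrite /perm_of in uv; have [q vE uE] := cat_eq_prefix uv le_uv.
case: q vE uE => [|i q] vE uE.
  by rewrite /same_perm [u]word_of_run_values [v]word_of_run_values size_uv uE /= eqxx.
have sorted_uv : sorted ltn (run_values false v ++ run_values true v).
  have := run_values_sorted false v; have := run_values_sorted true u.
  rewrite uE vE -catA; case: (run_values false u) => [|j l] //=.
  by rewrite !cat_path /= => iqT /and3P[-> -> _] /=; rewrite cat_path.
rewrite /same_perm size_uv eqxx !perm_of_sorted_ascending ?orbT //.
by rewrite /perm_of uv.
Qed.

Lemma same_perm_of u v : same_perm u v -> perm_of u = perm_of v.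
Proof.
case/orP=> [/eqP -> //|/and3P[asc_u asc_v /eqP uv]].
by rewrite !perm_of_ascending // uv.
Qed.

(** * The order on double ascents as the factor order on words *)

Lemma standardize_permutation s : is_permutation s -> standardize s = s.
Proof.
move=> /andP[_ s_perm]; rewrite /standardize -[RHS]map_id; apply/eq_in_map => x.
rewrite (perm_mem s_perm) mem_iota add1n ltnS => /andP[x_gt0 x_le].
rewrite (permP s_perm) -(subnKC x_le) iotaD count_cat.
rewrite (eq_in_count (a2 := predT)) ?count_predT ?size_iota => [|y]; last first.
  by rewrite mem_iota add1n ltnS => /andP[].
rewrite (eq_in_count (a2 := pred0)) ?count_pred0 ?addn0 // => y.
by rewrite mem_iota /=; lia.
Qed.

Lemma standardize_shift d s : standardize (map (addn d) s) = standardize s.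
Proof.
rewrite /standardize -map_comp; apply: eq_map => x /=.
by rewrite count_map; apply: eq_count => y /=; rewrite leq_add2l.
Qed.

Lemma restrict_perm_of w k n : k + n <= size w ->
  restrict_values (perm_of w) k.+1 (k + n) = map (addn k) (perm_of (take n (drop k w))).
Proof.
move=> kn_le; rewrite /restrict_values /perm_of filter_cat map_cat.
suff runE c : [seq x <- run_values c w | k < x <= k + n] =
    map (addn k) (run_values c (take n (drop k w))) by rewrite !runE.
rewrite /run_values size_takel ?size_drop; last by lia.
have -> : size w = k + (n + (size w - (k + n))) by lia.
rewrite -filter_predI 2!iotaD !filter_cat.
rewrite (eq_in_filter (a2 := pred0)) ?filter_pred0 => [|i]; last first.
  by rewrite mem_iota /= => i_in; apply/negbTE; rewrite negb_and; lia.
rewrite [X in _ ++ _ ++ X](eq_in_filter (a2 := pred0)) ?filter_pred0 => [|i]; last first.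
  by rewrite mem_iota /= => i_in; apply/negbTE; rewrite negb_and; lia.
rewrite cats0 /= (addnC 1 k) iotaDl filter_map; congr map; apply: eq_in_filter => i.
rewrite mem_iota /= => i_in; rewrite nth_take; last by lia.
rewrite nth_drop; have -> : (k + i).-1 = k + i.-1 by lia.
by rewrite andbC; case: (_ == c) => //=; lia.
Qed.

(** Restricting [perm_of w] to values between [k + 1] and [k + n] gives a shifted
    copy of the permutation of the factor of length [n] after the first [k]
    letters. *)
Lemma consecutive_leP s w : is_permutation s ->
  consecutive_le s (perm_of w) <-> exists2 u : seq bool, infix u w & s = perm_of u.
Proof.
move=> s_perm; have /andP[s_gt0 _] := s_perm; split.
  move=> [[|k] [// _]]; rewrite size_perm_of /isomorphic.
  have -> : k.+1 + size s - 1 = k + size s by lia.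
  move=> k_le; rewrite restrict_perm_of // standardize_shift standardize_permutation //.
  rewrite standardize_permutation => [->|]; last first.
    by apply: is_permutation_perm_of; rewrite size_takel // size_drop; lia.
  exists (take (size s) (drop k w)) => //.
  apply: (infix_trans (prefixW (prefix_take _ _))).
  by rewrite -{2}(cat_take_drop k w) suffix_infix.
move=> [u /subword_cat[p [t ->]] ->]; exists (size p).+1; rewrite !size_perm_of !size_cat.
have -> : (size p).+1 + size u - 1 = size p + size u by lia.
split=> //; first by rewrite addnA leq_addr.
rewrite /isomorphic restrict_perm_of ?size_cat ?addnA ?leq_addr // standardize_shift.
by rewrite drop_size_cat // take_size_cat.
Qed.

(** The witness can be [size r + 1], when [s] is empty. *)
Definition consecutive_leb (s r : seq nat) : bool :=
  has (fun k => [&& 1 <= k, k + size s - 1 <= size r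
    & standardize s == standardize (restrict_values r k (k + size s - 1))])
  (iota 0 (size r).+2).

Lemma consecutive_lebP s r : reflect (consecutive_le s r) (consecutive_leb s r).
Proof.
apply: (iffP hasP) => [[k _ /and3P[? ? /eqP ?]]|[k [k_gt0 k_le iso]]]; first by exists k.
exists k; first by rewrite mem_iota; lia.
by rewrite k_gt0 k_le; apply/eqP.
Qed.

Lemma da_permutation (x : DA) : is_permutation x.
Proof. by have /andP[] := da_seqP x. Qed.

Lemma da_word (x : DA) : exists2 u, 0 < size u & da_seq x = perm_of u.
Proof. exact: perm_of_surjective (da_seqP x). Qed.

Lemma da_le_refl x : da_le x x.
Proof.
have [u _ xE] := da_word x; rewrite /da_le {2}xE; apply/consecutive_leP.
  exact: da_permutation.
by exists u; first exact: infix_refl.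
Qed.

Lemma da_le_trans x y z : da_le x y -> da_le y z -> da_le x z.
Proof.
have [w _ zE] := da_word z; rewrite /da_le zE => xy.
move=> /consecutive_leP-/(_ (da_permutation y))[v vw yE]; move: xy; rewrite yE.
move=> /consecutive_leP-/(_ (da_permutation x))[u uv xE].
apply/consecutive_leP; first exact: da_permutation.
by exists u => //; apply: infix_trans uv vw.
Qed.

(** * Atomicity as directedness *)

Local Open Scope classical_set_scope.

Definition directed (T : Type) (le : T -> T -> Prop) (C : set T) : Prop :=
  forall x y, C x -> C y -> exists z, [/\ C z, le x z & le y z].

(** If [x] and [y] have no common upper bound, the elements of [C] not above [x]
    and those not above [y] are two proper down-closed sets covering [C]. *)
Lemma atomic_directed (T : Type) (le : T -> T -> Prop) (C : set T) :
  (forall x, le x x) -> (forall x y z, le x y -> le y z -> le x z) ->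
  down_closed le C -> atomic le C <-> directed le C.
Proof.
move=> refl trans downC; split=> [atC x y Cx Cy|dirC [C1 [C2 [d1 d2 [_ n1] [_ n2] CE]]]].
  apply: contrapT => no_join; apply: atC.
  have avoid_down a : down_closed le [set c | C c /\ ~ le a c].
    move=> c d [Cd ad] cd; split; first exact: downC Cd cd.
    by move=> ac; apply: ad; apply: trans ac cd.
  have avoid_proper a : C a -> ([set c | C c /\ ~ le a c] `<` C)%classic.
    by move=> Ca; split=> [c []//|/(_ a Ca)[_]]; apply.
  exists [set c | C c /\ ~ le x c], [set c | C c /\ ~ le y c]; split; auto.
  apply/seteqP; split=> [c Cc|c [[]|[]]//].
  have [xc|nxc] := EM (le x c); last by left.
  have [yc|nyc] := EM (le y c); last by right.
  by case: no_join; exists c.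
have [x [Cx nx]] : exists x, C x /\ ~ C1 x.
  by apply: contrapT => no; apply: n1 => x Cx; apply: contrapT => nx; apply: no; exists x.
have [y [Cy ny]] : exists y, C y /\ ~ C2 y.
  by apply: contrapT => no; apply: n2 => y Cy; apply: contrapT => ny; apply: no; exists y.
have [z [Cz xz yz]] := dirC _ _ Cx Cy.
by move: Cz; rewrite CE => -[/d1/(_ xz)|/d2/(_ yz)].
Qed.

Lemma Av_down_closed B : down_closed da_le (Av B).
Proof. by move=> x y Ay xy s /Ay nsy sx; apply: nsy; apply: da_le_trans sx xy. Qed.

(** * The language of a basis *)

Definition basis_language (B : seq DA) : pred (seq bool) :=
  fun w => all (fun s : DA => ~~ consecutive_leb s (perm_of w)) B.

Lemma basis_language_Av (B : seq DA) (x : DA) w : da_seq x = perm_of w ->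
  Av B x <-> basis_language B w.
Proof.
move=> xE; rewrite /basis_language -xE; split.
  by move=> Bx; apply/allP => s sB; apply/consecutive_lebP/Bx.
by move=> /allP Lw s /Lw /consecutive_lebP.
Qed.

Lemma basis_languageP B w : reflect
  (forall (s : DA) u, s \in B -> infix u w -> da_seq s <> perm_of u) (basis_language B w).
Proof.
apply: (iffP allP) => [Lw s u sB uw sE|Lw s sB].
  have /consecutive_lebP[] := Lw s sB; apply/(consecutive_leP _ (da_permutation s)).
  by exists u.
by apply/consecutive_lebP => /(consecutive_leP _ (da_permutation s))[u /(Lw _ _ sB)].
Qed.

Lemma basis_language_infix B (u w : seq bool) :
  infix u w -> basis_language B w -> basis_language B u.
Proof.
move=> uw /basis_languageP Lw; apply/basis_languageP => s v sB vu.
by apply: Lw sB _; apply: infix_trans vu uw.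
Qed.

Lemma infix_overlap (x y z v : seq bool) : size v <= (size y).+1 -> infix v (x ++ y ++ z) ->
  infix v (x ++ y) || infix v (y ++ z).
Proof.
move=> v_le /subword_cat[p [s E]].
have [le|lt] := leqP (size p + size v) (size x + size y).
  have [||r xyE _] := @cat_eq_prefix _ (p ++ v) s (x ++ y) z.
  - by rewrite -!catA E.
  - by rewrite !size_cat.
  by apply/orP; left; rewrite xyE -catA infix_infix.
have [||r _ yzE] := @cat_eq_prefix _ x (y ++ z) p (v ++ s) => //; first by lia.
by apply/orP; right; rewrite yzE infix_infix.
Qed.

Lemma size_le_code s : size s <= CodeSeq.code s.
Proof.
elim: s => //= x s IH; apply: leq_ltn_trans IH _; exact: ltn_code_behead.
Qed.

Lemma size_basis_element (B : seq DA) s : s \in B -> size s <= encode_basis B.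
Proof.
move=> sB; apply: leq_trans (size_le_code s) (ltnW _).
by apply: (allP (CodeSeq.ltn_code _)); apply: map_f.
Qed.

(** A factor of [x ++ y ++ z] not longer than [y] lies in [x ++ y] or in
    [y ++ z]; the code of [B] bounds the lengths of the forbidden factors. *)
Lemma basis_language_glue B (x y z : seq bool) : encode_basis B <= size y ->
  basis_language B (x ++ y) -> basis_language B (y ++ z) -> basis_language B (x ++ y ++ z).
Proof.
move=> y_long /basis_languageP Lxy /basis_languageP Lyz; apply/basis_languageP => s u sB.
move=> uxyz sE; have /infix_overlap/(_ uxyz)/orP[uxy|uyz] : size u <= (size y).+1.
- by rewrite -(size_perm_of u) -sE; have := size_basis_element sB; clear -y_long; lia.
- exact: Lxy sB uxy sE.
- exact: Lyz sB uyz sE.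
Qed.

(** * The decision procedure *)

(** Bounds the codes of the permutations of length at most [n]; see
    [ltn_code_bound]. *)
Definition code_bound n := 2 ^ (n.+1 * n.+1).

Lemma ltn_code_bound s n : is_permutation s -> size s <= n -> CodeSeq.code s < code_bound n.
Proof.
move=> /andP[_ s_perm] s_le.
have : all (fun i => i <= n) s.
  by rewrite (perm_all _ s_perm); apply/allP => i; rewrite mem_iota; lia.
suff gen t : all (fun i => i <= n) t -> CodeSeq.code t < 2 ^ (size t * n.+1).
  move=> /gen /leq_trans; apply; rewrite leq_pexp2l // leq_mul2r; lia.
elim: t => //= x t IH /andP[x_le /IH]; rewrite mulSn expnD => t_lt.
have x_pow : 2 ^ x.+1 <= 2 ^ n.+1 by rewrite leq_pexp2l.
apply: leq_trans (leq_mul x_pow t_lt); rewrite expnS.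
have := expn_gt0 2 x; nia.
Qed.

Definition in_avoidance_set (D : seq nat) (s : seq nat) : bool :=
  is_double_ascent s && all (fun c => ~~ consecutive_leb (CodeSeq.decode c) s) D.

Definition join_below (D : seq nat) (n : nat) (s t : seq nat) : bool :=
  has (fun c => [&& in_avoidance_set D (CodeSeq.decode c),
    consecutive_leb s (CodeSeq.decode c) & consecutive_leb t (CodeSeq.decode c)]) (iota 0 n).

Definition joins_below (D : seq nat) (m n : nat) : bool :=
  all (fun c => all (fun d =>
    in_avoidance_set D (CodeSeq.decode c) && in_avoidance_set D (CodeSeq.decode d) ==>
    join_below D n (CodeSeq.decode c) (CodeSeq.decode d)) (iota 0 m)) (iota 0 m).

Definition factor_bound b := code_bound (horizon b).
(** A sequence with code below [factor_bound b] has length below it, so that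
    [common_superword_bound] applies. *)
Definition join_bound b := code_bound (2 * factor_bound b + excursion b).

Definition atomicity_test (b : nat) : bool :=
  joins_below (CodeSeq.decode b) (factor_bound b) (join_bound b).

Lemma in_avoidance_setP (B : seq DA) s : reflect
  (exists2 x : DA, da_seq x = s & Av B x)
  (in_avoidance_set (CodeSeq.decode (encode_basis B)) s).
Proof.
rewrite /encode_basis CodeSeq.codeK /in_avoidance_set all_map.
apply: (iffP andP) => [[s_da /allP Bs]|[x <- Bx]].
  exists (MkDA s_da) => // r /Bs; rewrite /= CodeSeq.codeK => /consecutive_lebP; exact.
split; first exact: da_seqP.
by apply/allP => r rB; rewrite /= CodeSeq.codeK; apply/consecutive_lebP/Bx.
Qed.

(** Two elements within the first bound that have a common upper bound have one
    within the second bound. Conversely, a positive test joins all words up to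
    the horizon, hence all words of the language. *)
Lemma atomicity_testP (B : seq DA) :
  atomicity_test (encode_basis B) <-> directed da_le (Av B).
Proof.
set b := encode_basis B; pose L := basis_language B.
have L_infix := @basis_language_infix B; have L_glue := @basis_language_glue B.
have leP (x : DA) w : consecutive_le x (perm_of w) <->
    exists2 u : seq bool, infix u w & da_seq x = perm_of u.
  exact/consecutive_leP/da_permutation.
split=> [/allP test|dirB]; last first.
  apply/allP => c; rewrite mem_iota /= => c_lt; apply/allP => d; rewrite mem_iota /= => d_lt.
  apply/implyP => /andP[/in_avoidance_setP[x xc Bx] /in_avoidance_setP[y yd By]].
  have [z [Bz xz yz]] := dirB _ _ Bx By; have [w _ zE] := da_word z.
  move: xz yz; rewrite /da_le zE => /leP[u uw xE] /leP[v vw yE].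
  have /(basis_language_Av B zE) Lw := Bz.
  have [w' [Lw' uw' vw' w'_le]] := common_superword_bound L_infix L_glue Lw uw vw.
  have u_le : size u <= factor_bound b.
    rewrite -(size_perm_of u) -xE xc; apply: leq_trans (size_le_code _) _.
    by rewrite CodeSeq.decodeK ltnW.
  have v_le : size v <= factor_bound b.
    rewrite -(size_perm_of v) -yE yd; apply: leq_trans (size_le_code _) _.
    by rewrite CodeSeq.decodeK ltnW.
  have w'_gt0 : 0 < size w'.
    have /andP[x_gt0 _] := da_permutation x.
    have := size_infix uw'; rewrite -(size_perm_of u) -xE; exact: leq_trans.
  pose z' := MkDA (perm_of_double_ascent w'_gt0).
  apply/hasP; exists (CodeSeq.code z').
    rewrite mem_iota; apply: ltn_code_bound; first exact: da_permutation.
    by rewrite size_perm_of; move: w'_le u_le v_le; rewrite -/b; clear; lia.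
  rewrite CodeSeq.codeK -xc -yd; apply/and3P; split.
  - apply/in_avoidance_setP; exists z' => //.
    exact/(basis_language_Av B (erefl (da_seq z'))).
  - by apply/consecutive_lebP/leP; exists u.
  - by apply/consecutive_lebP/leP; exists v.
have short u v : L u -> L v -> size u <= horizon b -> size v <= horizon b -> joinable L u v.
  have refl w : same_perm w w by exact: same_perm_refl.
  move=> Lu Lv u_le v_le; case: (posnP (size u)) => [/size0nil ->|u_gt0].
    by exists v, [::], v; split; rewrite ?infix0s ?infix_refl.
  case: (posnP (size v)) => [/size0nil ->|v_gt0].
    by exists u, u, [::]; split; rewrite ?infix0s ?infix_refl.
  pose x := MkDA (perm_of_double_ascent u_gt0); pose y := MkDA (perm_of_double_ascent v_gt0).
  have codeP (t : DA) : size t <= horizon b -> CodeSeq.code t \in iota 0 (factor_bound b).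
    by move=> t_le; rewrite mem_iota; apply: ltn_code_bound; first exact: da_permutation.
  have x_le : size x <= horizon b by rewrite size_perm_of.
  have y_le : size y <= horizon b by rewrite size_perm_of.
  have := allP (test _ (codeP x x_le)) _ (codeP y y_le).
  rewrite (CodeSeq.codeK x) (CodeSeq.codeK y).
  have -> : in_avoidance_set (CodeSeq.decode b) x.
    by apply/in_avoidance_setP; exists x => //; apply/(basis_language_Av B (erefl (da_seq x))).
  have -> : in_avoidance_set (CodeSeq.decode b) y.
    by apply/in_avoidance_setP; exists y => //; apply/(basis_language_Av B (erefl (da_seq y))).
  move=> /hasP[c _ /and3P[/in_avoidance_setP[z <- Bz]]]; have [w _ zE] := da_word z.
  rewrite zE => /consecutive_lebP/leP[u' u'w /perm_of_inj uu'].
  move=> /consecutive_lebP/leP[v' v'w /perm_of_inj vv'].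
  by exists w, u', v'; split=> //; apply/(basis_language_Av B zE).
move=> x y Bx By; have [u u_gt0 xE] := da_word x; have [v _ yE] := da_word y.
have /(basis_language_Av B xE) Lu := Bx; have /(basis_language_Av B yE) Lv := By.
have [w [u' [v' [Lw uu' vv' u'w v'w]]]] := joinable_all L_infix L_glue short Lu Lv.
have w_gt0 : 0 < size w.
  have := size_infix u'w; rewrite -(size_perm_of u') -(same_perm_of uu') size_perm_of.
  exact: leq_trans.
pose z := MkDA (perm_of_double_ascent w_gt0); exists z; split.
- exact/(basis_language_Av B (erefl (da_seq z))).
- by apply/leP; exists u'; rewrite // xE; apply: same_perm_of.
- by apply/leP; exists v'; rewrite // yE; apply: same_perm_of.
Qed.

(** * The decision procedure is recursive *)

Lemma RecL_standardize s : RecL s -> RecL (fun v => standardize (s v)).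
Proof.
move=> rs; apply: (RecL_map (F := fun x v => count (fun y => y <= x) (s v))) => //.
apply: (Rec_count (P := fun y v => y <= v 0)); first exact/RecB_leq/Rec_var/Rec_var.
exact: RecL_reindex.
Qed.

Lemma RecL_restrict_values s k l : RecL s -> Rec k -> Rec l ->
  RecL (fun v => restrict_values (s v) (k v) (l v)).
Proof.
move=> rs rk rl; apply: (RecL_filter (P := fun x v => k v <= x <= l v)) => //.
by apply: RecB_and; apply: RecB_leq; try apply: Rec_var; apply: Rec_reindex.
Qed.

Lemma RecB_is_double_ascent s : RecL s -> RecB (fun v => is_double_ascent (s v)).
Proof.
move=> rs; have rsize := Rec_size rs.
have riota : RecL (fun v => iota 1 (size (s v))) by apply/RecL_iota/rsize/Rec_const.
apply: RecB_and; first apply: RecB_and.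
- exact/RecB_leq/rsize/Rec_const.
- apply: (RecB_all (P := fun x v => count_mem x (s v) == count_mem x (iota 1 (size (s v))))).
    have mem_one t : RecL t -> Rec (fun v => count_mem (v 0) (t (fun i => v i.+1))).
      move=> rt; apply: (Rec_count (P := fun y v => y == v 0)); last exact: RecL_reindex.
      exact/RecB_eq/Rec_var/Rec_var.
    by apply: RecB_eq; [apply: mem_one | apply: (mem_one (fun v => iota 1 (size (s v))))].
  exact: RecL_cat.
- apply: RecB_leq; last exact: Rec_const.
  apply: Rec_size.
  apply: (RecL_filter (P := fun i v => nth 0 (s v) i.+1 < nth 0 (s v) i)).
    have rs1 : RecL (fun v => s (fun i => v i.+1)) by apply: RecL_reindex.
    apply: RecB_leq; first apply: Rec_succ; apply: Rec_nth => //; last exact: Rec_var.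
    exact/Rec_succ/Rec_var.
  exact/RecL_iota/Rec_pred/rsize/Rec_const.
Qed.

Lemma RecB_consecutive_leb s r : RecL s -> RecL r ->
  RecB (fun v => consecutive_leb (s v) (r v)).
Proof.
move=> rs rr.
apply: (RecB_has_iota (P := fun k v => [&& 1 <= k, k + size (s v) - 1 <= size (r v)
    & standardize (s v) == standardize (restrict_values (r v) k (k + size (s v) - 1))])
    (m := fun v => (size (r v)).+2)); last exact/Rec_succ/Rec_succ/Rec_size.
have rs1 : RecL (fun v => s (fun i => v i.+1)) by apply: RecL_reindex.
have rr1 : RecL (fun v => r (fun i => v i.+1)) by apply: RecL_reindex.
have rend : Rec (fun v => v 0 + size (s (fun i => v i.+1)) - 1).
  by apply: Rec_sub; [apply/Rec_add/Rec_size => //; apply: Rec_var | apply: Rec_const].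
apply: RecB_and; first exact/RecB_leq/Rec_var/Rec_const.
apply: RecB_and; first exact/RecB_leq/Rec_size.
apply: RecB_eqseq; apply: RecL_standardize => //.
by apply: RecL_restrict_values => //; apply: Rec_var.
Qed.

Lemma RecB_in_avoidance_set D s : RecL D -> RecL s ->
  RecB (fun v => in_avoidance_set (D v) (s v)).
Proof.
move=> rD rs; apply: RecB_and; first exact: RecB_is_double_ascent.
apply: (RecB_all (P := fun c v => ~~ consecutive_leb (CodeSeq.decode c) (s v))) => //.
apply/RecB_negb/RecB_consecutive_leb; first exact/RecL_decode/Rec_var.
exact: RecL_reindex.
Qed.

Lemma RecB_join_below D n s t : RecL D -> Rec n -> RecL s -> RecL t ->
  RecB (fun v => join_below (D v) (n v) (s v) (t v)).
Proof.
move=> rD rn rs rt.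
apply: (RecB_has_iota (P := fun c v => [&& in_avoidance_set (D v) (CodeSeq.decode c),
    consecutive_leb (s v) (CodeSeq.decode c)
    & consecutive_leb (t v) (CodeSeq.decode c)])) => //.
have rc : RecL (fun v => CodeSeq.decode (v 0)) by apply/RecL_decode/Rec_var.
apply: RecB_and; first by apply: RecB_in_avoidance_set => //; apply: RecL_reindex.
by apply: RecB_and; apply: RecB_consecutive_leb => //; apply: RecL_reindex.
Qed.

Lemma RecB_joins_below D m n : RecL D -> Rec m -> Rec n ->
  RecB (fun v => joins_below (D v) (m v) (n v)).
Proof.
move=> rD rm rn.
apply: (RecB_all_iota (P := fun c v => all (fun d =>
    in_avoidance_set (D v) (CodeSeq.decode c) && in_avoidance_set (D v) (CodeSeq.decode d) ==>
    join_below (D v) (n v) (CodeSeq.decode c) (CodeSeq.decode d)) (iota 0 (m v)))) => //.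
apply: (RecB_all_iota (P := fun d v =>
    in_avoidance_set (D (fun i => v i.+1)) (CodeSeq.decode (v 0)) &&
    in_avoidance_set (D (fun i => v i.+1)) (CodeSeq.decode d) ==>
    join_below (D (fun i => v i.+1)) (n (fun i => v i.+1)) (CodeSeq.decode (v 0))
      (CodeSeq.decode d)) (m := fun v => m (fun i => v i.+1))); last exact: Rec_reindex.
have rD2 : RecL (fun v => D (fun i => v i.+2)) by apply: (RecL_reindex (fun i => i.+2)).
have rn2 : Rec (fun v => n (fun i => v i.+2)) by apply: (Rec_reindex (fun i => i.+2)).
have rv i : RecL (fun v => CodeSeq.decode (v i)) by apply/RecL_decode/Rec_var.
apply: RecB_implb; last exact: RecB_join_below.
by apply: RecB_and; apply: RecB_in_avoidance_set.
Qed.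

Lemma RecB_atomicity_test : RecB (fun v => atomicity_test (v 0)).
Proof.
have rexc : Rec (fun v => excursion (v 0)).
  by apply: Rec_add; [apply: Rec_exp; [apply: Rec_const|] |]; apply: Rec_var.
have rbound a : Rec a -> Rec (fun v => code_bound (a v)).
  by move=> ra; apply: Rec_exp; [apply: Rec_const | apply: Rec_mul; apply: Rec_succ].
have rfactor : Rec (fun v => factor_bound (v 0)).
  apply: rbound; apply: Rec_mul; first exact: Rec_const.
  by apply: Rec_add; [apply/Rec_add/Rec_var | apply: Rec_const].
apply: RecB_joins_below => //; first exact/RecL_decode/Rec_var.
by apply: rbound; apply: Rec_add => //; apply: Rec_mul => //; apply: Rec_const.
Qed.

Theorem theorem13p10 :
  algorithmically_decidable encode_basis (fun B : seq DA => atomic da_le (Av B)).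
Proof.
exists (fun t => atomicity_test (thead t)).
  exact: (recursive_Rec (F := atomicity_test) RecB_atomicity_test).
move=> B; rewrite (atomic_directed da_le_refl da_le_trans (@Av_down_closed B)).
rewrite -atomicity_testP /thead (tnth_nth 0) /=.
by case: (atomicity_test _); split=> // /(_ isT).
Qed.
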